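(* Let $\mathcal{H}$ be a complex Hilbert space and let $\alpha\in[0,1]$. Let $T=(T_{ij})$ be an $n\times n$ operator matrix, where $T_{ij}\in\mathcal{B}(\mathcal{H})$. Let $f$ and $g$ be two non-negative continuous functions on $[0,\infty)$ such that $f(t)g(t)=t$ for all $t\ge0$. Then $$\|T\|_{\alpha}\le\sqrt{\left\|\alpha|R|^2+(1-\alpha)|S|^2\right\|},$$ where $R=(r_{ij})_{n\times n}$ with $r_{ij}=\frac12\left(\|f^2(|T_{ij}|)\|^{\frac12}\|g^2(|T_{ij}^*|)\|^{\frac12}+\|f^2(|T_{ji}|)\|^{\frac12}\|g^2(|T_{ji}^*|)\|^{\frac12}\right)$ and $S=(s_{ij})_{n\times n}$ with $s_{ij}=\|T_{ij}\|$.
   Context: $\mathcal{B}(\mathcal{H})$ is the space of bounded linear operators on $\mathcal{H}$, and $\|\cdot\|$ is the usual operator norm. An $n\times n$ operator matrix $T=(T_{ij})$ acts on the Hilbert space direct sum $\oplus_{i=1}^n\mathcal{H}$ by $(Tx)_i=\sum_{j}T_{ij}x_j$. For a bounded operator $T$ on a complex Hilbert space $\mathcal{K}$: $|T|=(T^*T)^{1/2}$; and for $\alpha\in[0,1]$ the $\alpha$-norm is $\|T\|_{\alpha}=\sup\left\{\sqrt{\alpha|\langle Tx,x\rangle|^2+(1-\alpha)\|Tx\|^2}: x\in\mathcal{K},\ \|x\|=1\right\}$. Expressions $f^2(|T|)=(f(|T|))^2$ and $g^2(|T^*|)=(g(|T^*|))^2$ are understood via the continuous functional calculus. Scalar $n\times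 n$ matrices (such as $R,S$) are regarded as operators on $\mathbb{C}^n$ with the standard inner product. *)

(* Defs.v *)
From HB Require Import structures.
From mathcomp Require Import all_boot all_order all_algebra.
From mathcomp Require Import sesquilinear spectral complex ring.
From mathcomp Require Import all_classical all_reals all_analysis.

Set Implicit Arguments.
Unset Strict Implicit.
Unset Printing Implicit Defensive.

Import Order.TTheory GRing.Theory Num.Theory.
Import numFieldNormedType.Exports.

Local Open Scope classical_set_scope.
Local Open Scope ring_scope.
Local Open Scope complex_scope.

HB.mixin Record CompleteNormedModule_isHilbert (R : realType) H
    of CompleteNormedModule R[i] H := {
  inner : {dot H for (@Num.conj R[i])} ;
  innerE : forall x : H, inner x x = `|x| ^+ 2
}.

#[short(type="hilbertType")]
HB.structure Definition Hilbert (R : realType) :=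
  {H of CompleteNormedModule R[i] H & CompleteNormedModule_isHilbert R H}.

(* Linear in x, conjugate-linear in y. *)
Notation "''[' x , y ]" := (inner x y) : ring_scope.

Section scalars.
Variable R : realType.
Local Notation C := R[i].

(* The library has no topology on R[i]; it is taken from the norm, as for any
   numFieldType viewed as a module over itself. *)
HB.instance Definition _ := NormedModule.copy C C^o.

Lemma complex_complete (F : set_system C) :
  ProperFilter F -> cauchy F -> cvg F.
Proof.
move=> FF /cauchy_ballP cF.
have lip (h : C -> R) : (forall x y, `|h x - h y|%:C <= `|x - y|) ->
    cvg (h @ F).
  move=> hl; apply: cauchy_cvg; apply/cauchy_ballP => e e0.
  have e0' : 0 < e%:C by rewrite ltcR.
  have := cF _ e0'; rewrite !near2E => -[[A B]] /= [FA FB] AB.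
  exists (h @` A, h @` B) => /=.
    by split; rewrite nbhs_filterE /fmap /=; [move: FA | move: FB];
       apply: filterS => x ?; exists x.
  move=> [_ _] /= [[x Ax <-] [y By <-]].
  have := AB (x, y) (conj Ax By); rewrite /ball /= => xy.
  by rewrite -ltcR; exact: le_lt_trans (hl x y) xy.
have /cvg_ex[/= a Fa] : cvg (@complex.Re R @ F).
  by apply: lip => x y; rewrite -raddfB; exact: normc_ge_Re.
have /cvg_ex[/= b Fb] : cvg (@complex.Im R @ F).
  apply: lip => x y; rewrite -raddfB normc_def lecR -sqrtr_sqr.
  by rewrite ler_wsqrtr// lerDr sqr_ge0.
apply/cvg_ex; exists (a +i* b : C).
apply/cvgrPdist_le => e e0.
have [er er0 eE] : exists2 r : R, 0 < r & e = r%:C.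
  by exists (complex.Re e); rewrite -?ltcR RRe_real ?gtr0_real.
have er2 : 0 < er / 2 by rewrite divr_gt0.
move/cvgrPdist_le: Fa => /(_ _ er2) Fa.
move/cvgrPdist_le: Fb => /(_ _ er2) Fb.
have cE (w : C) : w = (complex.Re w)%:C + (complex.Im w)%:C * 'i%C.
  by case: w => u v; apply/eqP; rewrite eq_complex /=; apply/andP; split;
     apply/eqP; ring.
near=> x.
rewrite (cE (_ - x)) [complex.Re _]raddfB [complex.Im _]raddfB /=.
rewrite (le_trans (ler_normD _ _))// normrM eE [in leRHS](splitr er) [leRHS]rmorphD /= lerD//.
  rewrite normc_def /= expr0n addr0 sqrtr_sqr lecR; near: x; exact: Fa.
rewrite !normc_def /= !expr0n expr1n addr0 add0r sqrtr1 mulr1 sqrtr_sqr lecR.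
by near: x; exact: Fb.
Unshelve. all: by end_near. Qed.

HB.instance Definition _ := Uniform_isComplete.Build C complex_complete.

End scalars.

Section scalar_inner.
Variable R : realType.
Local Notation C := R[i].

Definition scalar_inner (x y : C) : C := x * Num.conj y.

Lemma scalar_inner_bilinear :
  bilinear_for *%R (Num.conj \; *%R) scalar_inner.
Proof.
split=> [y|x] a u v; rewrite /scalar_inner.
  by rewrite /= mulrDl -mulrA.
by rewrite /= rmorphD rmorphM mulrDr mulrCA.
Qed.

HB.instance Definition _ := bilinear_isBilinear.Build C C C C
  *%R (Num.conj \; *%R) scalar_inner scalar_inner_bilinear.

Lemma scalar_inner_herm (x y : C) :
  scalar_inner x y = (-1) ^+ false * Num.conj (scalar_inner y x).
Proof. by rewrite expr0 mul1r /scalar_inner rmorphM /= conjCK mulrC. Qed.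

HB.instance Definition _ :=
  isHermitianSesquilinear.Build C C false Num.conj scalar_inner scalar_inner_herm.

Lemma scalar_inner_gt0 (x : C) : x != 0 -> 0 < scalar_inner x x.
Proof. by rewrite /scalar_inner mul_conjC_gt0. Qed.

HB.instance Definition _ := isDotProduct.Build C C scalar_inner scalar_inner_gt0.

Lemma scalar_innerE (x : C) : scalar_inner x x = `|x| ^+ 2.
Proof. by rewrite normCK. Qed.

HB.instance Definition _ := CompleteNormedModule_isHilbert.Build R C scalar_innerE.
End scalar_inner.

Definition hsum (R : realType) (n : nat) (H : hilbertType R) :=
  {ffun 'I_n -> H}.

Section hsum.
Variables (R : realType) (n : nat) (H : hilbertType R).
Local Notation C := R[i].
Local Notation E := (hsum n H).

HB.instance Definition _ := GRing.Lmodule.copy E {ffun 'I_n -> H}.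

Definition hsum_inner (x y : E) : C := \sum_i '[x i, y i].

Lemma hsum_inner_bilinear :
  bilinear_for *%R (Num.conj \; *%R) hsum_inner.
Proof.
split=> [y|x] a u v; rewrite /hsum_inner /= mulr_sumr -big_split;
  apply: eq_bigr => i _; rewrite !ffunE.
  by rewrite linearPl.
by rewrite linearPr.
Qed.

HB.instance Definition _ := bilinear_isBilinear.Build C E E C
  *%R (Num.conj \; *%R) hsum_inner hsum_inner_bilinear.

Lemma hsum_inner_herm (x y : E) :
  hsum_inner x y = (-1) ^+ false * Num.conj (hsum_inner y x).
Proof.
rewrite expr0 mul1r /hsum_inner rmorph_sum; apply: eq_bigr => i _.
by rewrite hermC expr0 mul1r.
Qed.

HB.instance Definition _ :=
  isHermitianSesquilinear.Build C E false Num.conj hsum_inner hsum_inner_herm.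

Lemma hsum_inner_gt0 (x : E) : x != 0 -> 0 < hsum_inner x x.
Proof.
move=> x0; have [i xi] : exists i, x i != 0.
  apply/existsP; apply: contraNT x0; rewrite negb_exists => /forallP x0.
  by apply/eqP/ffunP => i; rewrite ffunE; apply/eqP/negPn.
rewrite /hsum_inner (bigD1 i)//= ltr_wpDr ?dnorm_gt0// sumr_ge0//.
Qed.

HB.instance Definition _ := isDotProduct.Build C E hsum_inner hsum_inner_gt0.

Definition hsum_norm (x : E) : C := sqrtC (\sum_i `|x i| ^+ 2).

Lemma hsum_normE (x : E) :
  hsum_norm x = sqrtC (dotmx (\row_i `|x i|) (\row_i `|x i|)).
Proof.
rewrite /hsum_norm dotmxE mxE; congr sqrtC; apply: eq_bigr => i _.
by rewrite !mxE geC0_conj ?normr_ge0 ?expr2.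
Qed.

Lemma hsum_norm_le (k : nat) (u v : 'I_k -> C) :
  (forall i, 0 <= u i <= v i) ->
  sqrtC (\sum_i u i ^+ 2) <= sqrtC (\sum_i v i ^+ 2).
Proof.
move=> uv; rewrite ler_sqrtC ?nnegrE ?sumr_ge0//.
- apply: ler_sum => i _; have /andP[u0 uv0] := uv i.
  by rewrite ler_sqr// nnegrE (le_trans u0).
- by move=> i _; have /andP[u0 uv0] := uv i; rewrite exprn_ge0.
- by move=> i _; have /andP[u0 uv0] := uv i; rewrite exprn_ge0// (le_trans u0).
Qed.

Lemma ler_hsum_normD (x y : E) :
  hsum_norm (x + y) <= hsum_norm x + hsum_norm y.
Proof.
have := (triangle_lerif (@dotmx C n) (\row_i `|x i|) (\row_i `|y i|)).1.
rewrite /= -!hsum_normE; apply: le_trans.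
have -> : dotmx (\row_i `|x i| + \row_i `|y i|) (\row_i `|x i| + \row_i `|y i|)
    = \sum_i (`|x i| + `|y i|) ^+ 2.
  rewrite dotmxE mxE; apply: eq_bigr => i _.
  by rewrite !mxE geC0_conj ?addr_ge0 ?normr_ge0// expr2.
by apply: hsum_norm_le => i; rewrite ffunE normr_ge0 ler_normD.
Qed.

Lemma hsum_normZ (a : C) (x : E) : hsum_norm (a *: x) = `|a| * hsum_norm x.
Proof.
rewrite /hsum_norm -(@sqrCK _ `|a|) ?normr_ge0// -rootCMl ?exprn_ge0//.
congr sqrtC; rewrite mulr_sumr; apply: eq_bigr => i _.
by rewrite ffunE normrZ exprMn.
Qed.

Lemma hsum_norm_coord (x : E) i : `|x i| <= hsum_norm x.
Proof.
rewrite -[leLHS]sqrCK// /hsum_norm ler_sqrtC ?nnegrE ?exprn_ge0//.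
  by rewrite (bigD1 i)//= lerDl sumr_ge0.
by rewrite sumr_ge0.
Qed.

Lemma hsum_norm0_eq0 (x : E) : hsum_norm x = 0 -> x = 0.
Proof.
move=> x0; apply/ffunP => i; rewrite ffunE; apply/eqP.
by rewrite -normr_le0 -x0 hsum_norm_coord.
Qed.

HB.instance Definition _ :=
  Lmodule_isNormed.Build C E ler_hsum_normD hsum_normZ hsum_norm0_eq0.

Lemma hsum_norm_le_sum (x : E) : `|x| <= \sum_i `|x i|.
Proof.
rewrite -[leLHS]/(hsum_norm x) /hsum_norm.
have s0 : 0 <= \sum_i `|x i| by rewrite sumr_ge0.
rewrite -[leRHS]sqrCK// ler_sqrtC ?nnegrE ?exprn_ge0//; last first.
  by rewrite sumr_ge0// => i _; rewrite exprn_ge0.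
rewrite [leRHS]expr2 mulr_sumr; apply: ler_sum => i _.
by rewrite expr2 ler_wpM2r// (bigD1 i)//= lerDl sumr_ge0.
Qed.

Lemma hsum_cvg (U : Type) (F : set_system U) (u : U -> E) (l : E) :
  Filter F -> (forall i, u x i @[x --> F] --> l i) -> u x @[x --> F] --> l.
Proof.
move=> FF cvgi; apply/cvgrPdist_le => e e0.
have e'0 : 0 < e / n.+1%:R by rewrite divr_gt0.
near=> x.
apply: le_trans (hsum_norm_le_sum _) _.
apply: (@le_trans _ _ (\sum_(i < n) e / n.+1%:R)); last first.
  rewrite sumr_const card_ord -[leLHS]mulr_natr -mulrA ler_piMr ?(ltW e0)//.
  by rewrite mulrC ler_pdivrMr ?mul1r ?ler_nat.
apply: ler_sum => i _; rewrite !ffunE; move: i.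
near: x.
apply: filter_forall => i.
by move/cvgrPdist_le: (cvgi i); apply.
Unshelve. all: by end_near. Qed.

Lemma hsum_proj_continuous i : continuous (fun x : E => x i).
Proof.
move=> x; apply/(@cvgrPdist_le _ _ _ (nbhs x)) => e e0; apply/nbhs_ballP; exists e => //= y.
rewrite -ball_normE /= => /ltW; apply: le_trans.
have -> : x i - y i = (x - y) i by rewrite !ffunE.
exact: hsum_norm_coord.
Qed.

Lemma hsum_complete (F : set_system E) : ProperFilter F -> cauchy F -> cvg F.
Proof.
move=> FF /cauchy_ballP cF.
have cvgi i : cvg ((fun x : E => x i) @ F).
  apply: cauchy_cvg; apply/cauchy_ballP => e e0.
  have := cF _ e0; rewrite !near2E => -[[A B]] /= [FA FB] AB.
  exists ((fun x : E => x i) @` A, (fun x : E => x i) @` B) => /=.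
    by split; rewrite nbhs_filterE /fmap /=; [move: FA | move: FB];
       apply: filterS => x ?; exists x.
  move=> [_ _] /= [[x Ax <-] [y By <-]].
  have := AB (x, y) (conj Ax By); rewrite -!ball_normE /= => xy.
  have -> : x i - y i = (x - y) i by rewrite !ffunE.
  exact: le_lt_trans (hsum_norm_coord _ _) xy.
pose l : E := [ffun i => lim ((fun x : E => x i) @ F)].
apply/cvg_ex; exists l; apply: hsum_cvg => i.
by rewrite /l ffunE; exact: cvgi.
Qed.

HB.instance Definition _ := Uniform_isComplete.Build E hsum_complete.

Lemma hsum_innerE (x : E) : hsum_inner x x = `|x| ^+ 2.
Proof. by rewrite sqrtCK; apply: eq_bigr => i _; rewrite innerE. Qed.

HB.instance Definition _ :=
  CompleteNormedModule_isHilbert.Build R E hsum_innerE.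
End hsum.

Definition bounded_linear (R : realType) (H : hilbertType R) : pred (H -> H) :=
  fun T => `[< linear T /\ bounded_near T (nbhs 0) >].

Record bounded_op (R : realType) (H : hilbertType R) := BoundedOp {
  bounded_op_fun :> H -> H ;
  _ : bounded_linear bounded_op_fun
}.

Notation "''B(' H )" := (bounded_op H) (format "''B(' H )") : type_scope.

Section bounded_op.
Variables (R : realType) (H : hilbertType R).
Local Notation C := R[i].

HB.instance Definition _ := [isSub for @bounded_op_fun R H].
HB.instance Definition _ := [Choice of 'B(H) by <:].

Lemma bounded_linearP (T : H -> H) :
  bounded_linear T <-> linear T /\ continuous T.
Proof.
pose mk (lT : linear T) : {linear H -> H} :=
  HB.pack T (GRing.isLinear.Build C H H *:%R T lT).
split=> [/asboolP[lT bT]|[lT cT]].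
  by split=> //; exact: (@bounded_linear_continuous _ _ _ (mk lT)).
apply/asboolP; split=> //.
by apply: (@continuous_linear_bounded _ _ _ 0 (mk lT)); exact: cT.
Qed.

Lemma bounded_opP (T : 'B(H)) : linear T /\ continuous T.
Proof. by apply/bounded_linearP; exact: valP T. Qed.

Lemma bounded_linear_submod_closed : GRing.subsemimod_closed (@bounded_linear R H).
Proof.
split; first split.
- apply/bounded_linearP; split; last exact: cst_continuous.
  by move=> a x y; rewrite -[RHS]/(a *: 0 + 0 : H) scaler0 addr0.
- move=> S T /bounded_linearP[lS cS] /bounded_linearP[lT cT].
  apply/bounded_linearP; split.
    move=> a x y; rewrite -[RHS]/(a *: (S x + T x) + (S y + T y)).
    by rewrite -[LHS]/(S _ + T _) lS lT scalerDr addrACA.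
  by move=> x; apply: continuousD; [exact: cS | exact: cT].
move=> a T /bounded_linearP[lT cT]; apply/bounded_linearP; split.
  move=> b x y; rewrite -[LHS]/(a *: T _) -[RHS]/(b *: (a *: T x) + a *: T y).
  by rewrite lT scalerDr !scalerA mulrC.
by move=> x; apply: cvgZl_tmp; exact: cT.
Qed.

HB.instance Definition _ :=
  GRing.SubChoice_isSubLmodule.Build C (H -> H) _ 'B(H)
    bounded_linear_submod_closed.

Lemma bounded_linear_id : bounded_linear (@idfun H).
Proof. by apply/bounded_linearP; split=> // x; exact: cvg_id. Qed.

Lemma bounded_linear_comp (S T : 'B(H)) : bounded_linear (S \o T).
Proof.
have [lS cS] := bounded_opP S; have [lT cT] := bounded_opP T.
apply/bounded_linearP; split; first by move=> a x y; rewrite /= lT lS.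
by move=> x; apply: continuous_comp; [exact: cT | exact: cS].
Qed.

Definition op1 : 'B(H) := BoundedOp bounded_linear_id.
Definition opM (S T : 'B(H)) : 'B(H) := BoundedOp (bounded_linear_comp S T).

Lemma opMA : associative opM. Proof. by move=> S T U; exact: val_inj. Qed.
Lemma op1M : left_id op1 opM. Proof. by move=> T; exact: val_inj. Qed.
Lemma opM1 : right_id op1 opM. Proof. by move=> T; exact: val_inj. Qed.
Lemma opMDl : left_distributive opM +%R.
Proof. by move=> S T U; exact: val_inj. Qed.
Lemma opMDr : right_distributive opM +%R.
Proof.
move=> S T U; apply: val_inj; apply/funext => x /=.
have [lS _] := bounded_opP S.
by have := lS 1 (T x) (U x); rewrite !scale1r.
Qed.

HB.instance Definition _ :=
  GRing.Zmodule_isPzRing.Build 'B(H) opMA op1M opM1 opMDl opMDr.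

(* Norms and moduli are elements of R[i] here; Re turns these (real) values into
   elements of R. *)
Definition opnorm (T : 'B(H)) : R :=
  sup [set complex.Re `|T x| | x in [set x : H | `|x| <= 1]].

(* If H = 0 there is no unit vector and sup set0 = 0. *)
Definition alpha_norm (alpha : R) (T : 'B(H)) : R :=
  sup [set Num.sqrt (alpha * complex.Re `|'[T x, x]| ^+ 2
                     + (1 - alpha) * complex.Re `|T x| ^+ 2)
      | x in [set x : H | `|x| = 1]].

(* Exists, by the Riesz representation theorem, and is unique. *)
Definition adjoint (T : 'B(H)) : 'B(H) :=
  xget 0 [set S : 'B(H) | forall x y : H, '[T x, y] = '[x, S y]].

Definition spectrum (T : 'B(H)) : set C :=
  [set z | ~ exists S : 'B(H), S * (z *: (1 : 'B(H)) - T) = 1 /\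
                               (z *: (1 : 'B(H)) - T) * S = 1].

Definition op_poly (p : {poly R}) (T : 'B(H)) : 'B(H) :=
  \sum_(k < size p) (p`_k)%:C *: T ^+ k.

(* Continuous functional calculus of a self-adjoint operator T: the norm limit
   of p_k(T), for real polynomials p_k converging to f uniformly on the spectrum
   of T, which consists of real numbers. By the Weierstrass theorem and
   ||p(T)|| = sup |p| over the spectrum of T, the limit exists as soon as f is
   continuous on the spectrum, and it does not depend on the choice of p_k. *)
Definition cfc (f : R -> R) (T : 'B(H)) : 'B(H) :=
  xget 0 [set S : 'B(H) | exists p : nat -> {poly R},
    {uniform [set t : R | spectrum T t%:C], (fun k t => (p k).[t]) @ \oo --> f} /\
    opnorm (op_poly (p k) T - S) @[k --> \oo] --> 0].

Definition opabs (T : 'B(H)) : 'B(H) := cfc Num.sqrt (adjoint T * T).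

End bounded_op.

Section operator_matrix.
Variables (R : realType) (H : hilbertType R) (n : nat) (T : 'M['B(H)]_n).

Definition opmx_fun (x : hsum n H) : hsum n H :=
  [ffun i => \sum_j T i j (x j)].

Lemma opmx_subproof : bounded_linear opmx_fun.
Proof.
apply/bounded_linearP; split.
  move=> a x y; apply/ffunP => i; rewrite !ffunE scaler_sumr -big_split.
  apply: eq_bigr => j _; rewrite !ffunE /=.
  by have [-> _] := bounded_opP (T i j).
move=> x; apply: (@hsum_cvg _ _ _ _ (nbhs x)) => i; rewrite ffunE.
under eq_fun do rewrite ffunE.
apply: (@cvg_big _ _ _ _ _ _ _ (nbhs x)) => [|j _]; first exact: add_continuous.
apply: (@continuous_comp _ _ _ (fun x : hsum n H => x j) (T i j)).
  exact: hsum_proj_continuous.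
by have [_] := bounded_opP (T i j); exact.
Qed.

Definition opmx : 'B(hsum n H) := BoundedOp opmx_subproof.

End operator_matrix.

(* C^n with the standard inner product is hsum n R[i], and the scalar a acts on
   R[i] as a *: 1, that is, x |-> a * x (see mxopE). *)
Definition mxop (R : realType) (n : nat) (A : 'M[R[i]]_n) : 'B(hsum n R[i]) :=
  opmx (map_mx (fun a : R[i] => a *: (1 : 'B(R[i]))) A).

Lemma mxopE (R : realType) (n : nat) (A : 'M[R[i]]_n) (x : hsum n R[i]) i :
  mxop A x i = \sum_j A i j * x j.
Proof. by rewrite ffunE; apply: eq_bigr => j _; rewrite mxE. Qed.

(* Main.v *)
Require Import Defs.
From HB Require Import structures.
From mathcomp Require Import all_boot all_order all_algebra.
From mathcomp Require Import sesquilinear complex ring lra.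
From mathcomp Require Import all_classical all_reals all_analysis.

Set Implicit Arguments.
Unset Strict Implicit.
Unset Printing Implicit Defensive.

Import Order.TTheory GRing.Theory Num.Theory.
Import numFieldNormedType.Exports.

Local Open Scope classical_set_scope.
Local Open Scope ring_scope.
Local Open Scope complex_scope.

(** Let [x] be a unit vector of the direct sum and [v] the vector of the norms of
    its coordinates, a unit vector of [C^n]. Suppose that [a i j >= |T i j|] for
    all [i] and [j]. Then [|<T x, x>|] is at most the quadratic form of [a] at
    [v], which is that of its symmetric part [R], so it is at most [|R v|]; and
    [|T x| <= |S v|]. As [|R v|^2 = <|R|^2 v, v>], and likewise for [S], the number
    [alpha |<T x, x>|^2 + (1 - alpha) |T x|^2] is at most
    [<(alpha |R|^2 + (1 - alpha) |S|^2) v, v>], hence at most the norm of that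
    operator ([alpha_norm_opmx_le]).

    It remains to see that the products [a i j] of the theorem dominate the norms
    of the entries ([opnorm_le_cfc]). For an operator [T] of norm [M > 0], the
    positive operators [|T|] and [|T^*|] have norm [M] as well, and the norm of a
    positive operator is one of its approximate eigenvalues. Therefore
    [f(|T|)^2] has norm at least [f(M)^2], and [g(|T^*|)^2] has norm at least
    [g(M)^2]. The product of the square roots is at least [f(M) g(M) = M].

    The rest is the operator theory behind the words modulus and functional
    calculus. Both are limits of polynomials, and they exist because real
    polynomials approximate continuous functions uniformly on segments
    ([weierstrass]), because operators form a complete space ([op_complete]), and
    because the norm of [p(A)] is at most the supremum of [|p|] on the spectrum of
    the self-adjoint operator [A] ([opnorm_poly_le]). The last point is proved
    without a spectral radius: for [N = |p(A)|], the operator [p(A)^2 - N^2] is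
    not bounded below, so in the factorisation of [p^2 - N^2] over the complex
    numbers some factor is not bounded below at [A]; its root is real, lies in the
    spectrum, and is a point where [|p| = N]. The spectrum of a positive operator
    lies in the half-line where [f] and [g] are continuous
    ([positive_spectrum]), by the Neumann series. *)

(** * Weierstrass approximation on a segment *)

Section binomial_mean.

(** The mean of [phi k] when [k] is binomially distributed with parameters [n]
    and [x], obtained by conditioning on the first trial. With [phi k] equal to
    [f (k / n)] it is the [n]-th Bernstein polynomial of [f] at [x]. The
    recursion avoids binomial coefficients, and taking [A] to be a polynomial
    ring produces the polynomial and its values from one definition. *)
Fixpoint binomial_mean (A : comNzRingType) (x : A) n (phi : nat -> A) : A :=
  if n is m.+1 then
    x * binomial_mean x m (phi \o succn) + (1 - x) * binomial_mean x m phi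
  else phi 0%N.

Lemma horner_binomial_mean (A : comNzRingType) (u : {poly A}) n phi t :
  (binomial_mean u n (polyC \o phi)).[t] = binomial_mean u.[t] n phi.
Proof.
elim: n phi => [|n IHn] phi /=; first by rewrite hornerC.
by rewrite hornerD !hornerM hornerD hornerN hornerC -!IHn.
Qed.

Lemma binomial_mean_affine (A : comNzRingType) (x c d : A) n phi :
  binomial_mean x n (fun k => c + d * phi k) = c + d * binomial_mean x n phi.
Proof.
elim: n phi => [//|n IHn] phi /=.
have IH1 := IHn (phi \o succn); rewrite /comp /= in IH1 *.
by rewrite IH1 IHn; ring.
Qed.

(** The mean [n x] and the variance [n x (1 - x)], in one statement: the shift
    [c] is what makes the induction go through, as the first trial moves it. *)
Lemma binomial_mean_sqr (A : comNzRingType) (x c : A) n :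
  binomial_mean x n (fun k => (k%:R + c) ^+ 2) =
  (n%:R * x + c) ^+ 2 + n%:R * x * (1 - x).
Proof.
elim: n c => [|n IHn] c /=; first by ring.
have -> : (fun k => (k%:R + c) ^+ 2) \o succn = (fun k => (k%:R + (1 + c)) ^+ 2).
  by apply/funext => k /=; rewrite addrA -natr1.
by rewrite !IHn -natr1; ring.
Qed.

Lemma ler_binomial_mean (R : realType) (x : R) n (phi psi : nat -> R) :
  0 <= x <= 1 -> (forall k, (k <= n)%N -> phi k <= psi k) ->
  binomial_mean x n phi <= binomial_mean x n psi.
Proof.
move=> /andP[x0 x1]; elim: n phi psi => [|n IHn] phi psi le /=; first exact: le.
apply: lerD; apply: ler_wpM2l; rewrite ?subr_ge0//; apply: IHn => k kn.
  exact: le.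
by apply: le; apply: leqW.
Qed.

End binomial_mean.

Section weierstrass.
Context {R : realType}.

(** Compactness in the form of near-coverings: locally the property holds for
    all small enough [d], so a single [d] works on the whole segment. *)
Lemma segment_unif_continuous (f : R -> R) (a b e : R) :
  {within `[a, b], continuous f} -> 0 < e ->
  exists2 d : R, 0 < d & forall s t, s \in `[a, b] -> t \in `[a, b] ->
    `|s - t| < d -> `|f s - f t| < e.
Proof.
move=> fc e0.
have e20 : 0 < e / 2 by rewrite divr_gt0.
have := @segment_compact R a b; rewrite compact_near_coveringP => cov.
pose P (d : R) (s : R) := s \in `[a, b] -> forall t, t \in `[a, b] ->
  `|s - t| < d -> `|f s - f t| < e.
have : \forall d \near 0^'+, `[a, b] `<=` P d.
  apply: cov => x xab.
  have /subspace_continuousP/(_ x xab)/cvgrPdist_lt/(_ _ e20) := fc.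
  rewrite near_withinE => /nbhs_ballP[r /= r0 xr].
  have r20 : 0 < r / 2 by rewrite divr_gt0.
  exists (ball x (r / 2), [set d | d < r / 2]).
    split => /=; first by apply: nbhsx_ballx.
    exact: nbhs_right_lt.
  move=> [s d] /= [xs dr] sab t tab st.
  have fx z : z \in `[a, b] -> `|x - z| < r -> `|f x - f z| < e / 2.
    move=> zab xz; apply: xr => //.
  rewrite -(subrKA (f x)) (le_lt_trans (ler_normD _ _))// (splitr e) ltrD//.
    rewrite distrC; apply: fx => //; apply: lt_le_trans xs _.
    by rewrite ler_pdivrMr// ler_peMr ?ler1n ?ltW.
  apply: fx => //; rewrite -(subrKA s) (le_lt_trans (ler_normD _ _))// (splitr r) ltrD//.
  exact: lt_trans dr.
move=> nP; near (0 : R)^'+ => d.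
exists d; first by near: d; exact: nbhs_right_gt.
move=> s t sab tab; have : `[a, b] `<=` P d by near: d.
by move=> /(_ s sab sab t tab).
Unshelve. all: by end_near. Qed.

Lemma segment_bounded (f : R -> R) (a b : R) :
  {within `[a, b], continuous f} ->
  exists2 K : R, 0 <= K & forall t, t \in `[a, b] -> `|f t| <= K.
Proof.
move=> fc.
have := continuous_compact fc (@segment_compact _ a b).
move/compact_bounded => [K [Kr fK]].
exists (Num.max 0 (K + 1)); first by rewrite le_max lexx.
move=> t tab; rewrite le_max; apply/orP; right.
by apply: (fK (K + 1)); [rewrite ltrDl|exists t].
Qed.

(** Bernstein's argument with the Chebyshev bound: [f (b k / n)] differs from
    [f t] by at most [e / 2] when [b k / n] is within [d] of [t], and by at most
    [2 K] times the square of their distance divided by [d] otherwise. Averaging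
    over [k], the second term is of order [1 / n] by the variance formula. *)
Lemma weierstrass (f : R -> R) (b e : R) :
  0 < b -> {within `[0, b], continuous f} -> 0 < e ->
  exists p : {poly R}, forall t, 0 <= t <= b -> `|p.[t] - f t| < e.
Proof.
move=> b0 fc e0.
have e20 : 0 < e / 2 by rewrite divr_gt0.
have [d d0 fd] := segment_unif_continuous fc e20.
have [K K0 fK] := segment_bounded fc.
pose c := 2 * K * (b / d) ^+ 2.
have c0 : 0 <= c by rewrite mulr_ge0 ?sqr_ge0 ?mulr_ge0.
pose n := (Num.truncn (c / (e / 2))).+1.
have n0 : 0 < n%:R :> R by rewrite ltr0n.
have nc : c < e / 2 * n%:R.
  by rewrite mulrC -ltr_pdivrMr// truncnS_gt.
pose phi k : R := f (b * (k%:R / n%:R)).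
exists (binomial_mean (b^-1 *: 'X) n (polyC \o phi)) => t /andP[t0 tb].
rewrite horner_binomial_mean hornerZ hornerX.
set x := b^-1 * t.
have tE : t = b * x by rewrite /x mulrA mulfV ?mul1r ?gt_eqF.
have x01 : 0 <= x <= 1.
  by rewrite mulr_ge0 ?invr_ge0 ?(ltW b0)//= ler_pdivrMl// mulr1.
have tab : t \in `[0, b] by rewrite in_itv /= t0.
pose D (k : nat) : R := e / 2 + (c / n%:R ^+ 2) * (k%:R + - (n%:R * x)) ^+ 2.
have phiD k : (k <= n)%N -> `|phi k - f t| <= D k.
  move=> kn; rewrite /phi.
  have k01 : 0 <= (k%:R / n%:R : R) <= 1.
    by rewrite divr_ge0//= ler_pdivrMr// mul1r ler_nat.
  have sab : b * (k%:R / n%:R) \in `[0, b].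
    rewrite in_itv /=; case/andP: k01 => k0 k1.
    by rewrite mulr_ge0 ?(ltW b0)//= ler_piMr// ltW.
  have [lt|ge] := ltP `|b * (k%:R / n%:R) - t| d.
    rewrite (le_trans (ltW (fd _ _ sab tab lt)))// lerDl mulr_ge0 ?sqr_ge0//.
    by rewrite divr_ge0// exprn_ge0.
  apply: (@le_trans _ _ (2 * K)).
    rewrite (le_trans (ler_normB _ _))// mulr2n mulrDl mul1r lerD ?fK//.
  apply: (@le_trans _ _ (c / n%:R ^+ 2 * (k%:R + - (n%:R * x)) ^+ 2)); last first.
    by rewrite lerDr ltW.
  have -> : c / n%:R ^+ 2 * (k%:R + - (n%:R * x)) ^+ 2 =
      2 * K * (`|b * (k%:R / n%:R) - t| / d) ^+ 2.
    rewrite expr_div_n -normrX ger0_norm ?sqr_ge0// /c tE.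
    by field; rewrite !gt_eqF.
  rewrite ler_peMr ?mulr_ge0// expr_ge1// ?divr_ge0 ?(ltW d0)//.
  by rewrite ler_pdivlMr// mul1r.
have mD : binomial_mean x n D < e.
  rewrite binomial_mean_affine binomial_mean_sqr.
  rewrite subrr expr0n add0r [ltRHS]splitr ltrD2l.
  apply: (@le_lt_trans _ _ (c / n%:R)).
    have -> : c / n%:R ^+ 2 * (n%:R * x * (1 - x)) = c / n%:R * (x * (1 - x)).
      by field; rewrite gt_eqF.
    rewrite ler_piMr ?divr_ge0 ?(ltW n0)//.
    by case/andP: x01 => ? ?; nra.
  by rewrite ltr_pdivrMr.
apply: le_lt_trans mD.
(* The sign [s] gives both halves of the bound on the absolute value from the
   monotonicity of the mean. *)
have mB (s : R) : binomial_mean x n (fun k => - s * f t + s * phi k) =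
   s * (binomial_mean x n phi - f t).
  by rewrite binomial_mean_affine; ring.
rewrite ler_norml; apply/andP; split.
  rewrite lerNl -mulN1r -mB; apply: ler_binomial_mean => // k /phiD.
  by rewrite ler_norml => /andP[? _]; lra.
rewrite -[leLHS]mul1r -mB; apply: ler_binomial_mean => // k /phiD.
by rewrite ler_norml => /andP[_ ?]; lra.
Qed.

End weierstrass.
(** * Real-valued norm and inner product of a Hilbert space *)

Section complex_modulus.
Context {R : realType}.
Implicit Types a b : R[i].

(* Real parts of norms must not be simplified into square roots of sums of squares. *)
Definition cabs a : R := complex.Re `|a|.
Arguments cabs : simpl never.

Lemma cabsE a : `|a| = (cabs a)%:C.
Proof. by rewrite RRe_real// normr_real. Qed.

Lemma cabs_ge0 a : 0 <= cabs a.
Proof. by rewrite -ler0c -cabsE. Qed.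

Lemma cabsr (c : R) : cabs c%:C = `|c|.
Proof. by rewrite /cabs normc_def /= expr0n addr0 sqrtr_sqr. Qed.

Lemma ler_cabs_Re a : `|complex.Re a| <= cabs a.
Proof. by rewrite -lecR -cabsE normc_ge_Re. Qed.

Lemma Re_conj a : complex.Re (Num.conj a) = complex.Re a.
Proof. by case: a. Qed.

Lemma Re_realM (c : R) a : complex.Re (c%:C * a) = c * complex.Re a.
Proof. by case: a => u v /=; rewrite mul0r subr0. Qed.

End complex_modulus.
Arguments cabs : simpl never.

Section hilbert_norm.
Context {R : realType} {H : hilbertType R}.
Local Notation C := R[i].
Implicit Types (x y z : H) (a b : C).

Definition hnorm x : R := complex.Re `|x|.
(** The real part of the inner product turns [H] into a real inner product
    space, in which estimates are inequalities between elements of [R] and not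
    of the partially ordered field [R[i]]. *)
Definition rip x y : R := complex.Re '[x, y].
Arguments hnorm : simpl never.
Arguments rip : simpl never.

Lemma hnormE x : `|x| = (hnorm x)%:C.
Proof. by rewrite RRe_real// normr_real. Qed.

Lemma hnorm_ge0 x : 0 <= hnorm x.
Proof. by rewrite -ler0c -hnormE. Qed.

Lemma hnorm_eq0 x : (hnorm x == 0) = (x == 0).
Proof. by rewrite -[RHS]normr_eq0 hnormE -(inj_eq (@complexI R)). Qed.

Lemma hnorm_gt0 x : (0 < hnorm x) = (x != 0).
Proof. by rewrite lt_neqAle eq_sym hnorm_eq0 hnorm_ge0 andbT. Qed.

Lemma hnorm0 : hnorm 0 = 0.
Proof. by apply/eqP; rewrite hnorm_eq0. Qed.

Lemma ler_hnormD x y : hnorm (x + y) <= hnorm x + hnorm y.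
Proof. by rewrite -lecR rmorphD /= -!hnormE ler_normD. Qed.

Lemma hnormZ a x : hnorm (a *: x) = cabs a * hnorm x.
Proof. by apply: complexI; rewrite rmorphM /= -!hnormE normrZ cabsE. Qed.

Lemma hnormZr (c : R) x : hnorm (c%:C *: x) = `|c| * hnorm x.
Proof. by rewrite hnormZ cabsr. Qed.

Lemma hnormN x : hnorm (- x) = hnorm x.
Proof. by rewrite /hnorm normrN. Qed.

Lemma hdistC x y : hnorm (x - y) = hnorm (y - x).
Proof. by rewrite /hnorm distrC. Qed.

Lemma ler_dist_hnorm x y : `|hnorm x - hnorm y| <= hnorm (x - y).
Proof.
rewrite ler_norml; have := ler_hnormD (x - y) y; rewrite subrK.
have := ler_hnormD (y - x) x; rewrite subrK hdistC.
by move=> ? ?; apply/andP; split; lra.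
Qed.

Lemma innerC x y : '[x, y] = Num.conj '[y, x].
Proof. by rewrite hermC expr0 mul1r. Qed.

Lemma innerZl a x y : '[a *: x, y] = a * '[x, y].
Proof. by rewrite linearZl_LR. Qed.

Lemma innerZr a x y : '[x, a *: y] = Num.conj a * '[x, y].
Proof. by rewrite linearZr_LR. Qed.

Lemma hnorm_sqr x : hnorm x ^+ 2 = rip x x.
Proof. by rewrite /rip innerE hnormE -rmorphXn. Qed.

Lemma ripC x y : rip x y = rip y x.
Proof. by rewrite /rip innerC Re_conj. Qed.

Lemma ripDl x y z : rip (x + y) z = rip x z + rip y z.
Proof. by rewrite /rip linearDl raddfD. Qed.

Lemma ripNl x z : rip (- x) z = - rip x z.
Proof. by rewrite /rip linearNl raddfN. Qed.

Lemma ripZl (c : R) x z : rip (c%:C *: x) z = c * rip x z.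
Proof. by rewrite /rip innerZl Re_realM. Qed.

Lemma ripDr x y z : rip z (x + y) = rip z x + rip z y.
Proof. by rewrite !(ripC z) ripDl. Qed.

Lemma ripNr x z : rip z (- x) = - rip z x.
Proof. by rewrite !(ripC z) ripNl. Qed.

Lemma ripZr (c : R) x z : rip z (c%:C *: x) = c * rip z x.
Proof. by rewrite !(ripC z) ripZl. Qed.

Definition ripE := (ripDl, ripDr, ripNl, ripNr, ripZl, ripZr).

Lemma hnorm_sqrD x y : hnorm (x + y) ^+ 2 = hnorm x ^+ 2 + 2 * rip x y + hnorm y ^+ 2.
Proof. by rewrite !hnorm_sqr !ripE (ripC y x); ring. Qed.

Lemma hnorm_sqrB x y : hnorm (x - y) ^+ 2 = hnorm x ^+ 2 - 2 * rip x y + hnorm y ^+ 2.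
Proof. by rewrite !hnorm_sqr !ripE (ripC y x); ring. Qed.

(** Expand the squared norm of [|y|^2 x - <x, y> y], which is nonnegative. *)
Lemma cauchy_schwarz x y : cabs '[x, y] <= hnorm x * hnorm y.
Proof.
have [->|y0] := eqVneq y 0.
  by rewrite linear0r /cabs normr0 hnorm0 mulr0.
have b0 : 0 < hnorm y ^+ 2 by rewrite exprn_gt0// hnorm_gt0.
rewrite -ler_sqr ?nnegrE ?mulr_ge0 ?hnorm_ge0 ?cabs_ge0// exprMn.
set a := '[x, y].
have : 0 <= hnorm ((hnorm y ^+ 2)%:C *: x - a *: y) ^+ 2 by rewrite sqr_ge0.
rewrite hnorm_sqrB ripZl {1}/rip innerZr -/a [in X in complex.Re X]mulrC -normCK cabsE -rmorphXn /=.
rewrite hnormZr hnormZ (gtr0_norm b0) !exprMn.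
have -> : (hnorm y ^+ 2) ^+ 2 * hnorm x ^+ 2 - 2 * (hnorm y ^+ 2 * cabs a ^+ 2) +
   cabs a ^+ 2 * hnorm y ^+ 2 = hnorm y ^+ 2 * (hnorm x ^+ 2 * hnorm y ^+ 2 - cabs a ^+ 2).
  by ring.
by rewrite pmulr_rge0// subr_ge0.
Qed.

Lemma ler_rip x y : `|rip x y| <= hnorm x * hnorm y.
Proof. exact: le_trans (ler_cabs_Re _) (cauchy_schwarz _ _). Qed.

Lemma hnorm_cauchy_cvg (u : nat -> H) :
  (forall e : R, 0 < e -> exists N, forall m n, (N <= m)%N -> (N <= n)%N ->
     hnorm (u m - u n) <= e) ->
  exists l, hnorm (u n - l) @[n --> \oo] --> 0.
Proof.
move=> uc.
have /cvg_ex[l ul] : cvg (u @ \oo).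
  apply: cauchy_cvg; apply/cauchy_ballP => e e0.
  have [er er0 eE] : exists2 r : R, 0 < r & e = r%:C.
    by exists (complex.Re e); rewrite -?ltcR RRe_real ?gtr0_real.
  have [|N uN] := uc (er / 2); first by rewrite divr_gt0.
  rewrite near2E; exists (u @` [set n | (N <= n)%N], u @` [set n | (N <= n)%N]).
    by split; exists N => // n /= Nn; exists n.
  move=> [_ _] /= [[m Nm <-] [n Nn <-]]; rewrite -ball_normE /= hnormE eE ltcR.
  by rewrite (le_lt_trans (uN _ _ Nm Nn))// ltr_pdivrMr// ltr_pMr// ltr1n.
exists l; apply/cvgrPdist_le => e e0.
have e0' : 0 < e%:C by rewrite ltcR.
move/cvgrPdist_le: ul => /(_ _ e0') [N _ uN]; exists N => // n /= Nn.
rewrite sub0r normrN ger0_norm ?hnorm_ge0// hdistC.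
by have := uN n Nn; rewrite hnormE lecR.
Qed.

Lemma cvg_hnorm (u : nat -> H) l :
  hnorm (u n - l) @[n --> \oo] --> 0 -> hnorm (u n) @[n --> \oo] --> hnorm l.
Proof.
move=> ul; apply/cvgrPdist_le => e e0.
move/cvgrPdist_le: ul => /(_ _ e0) [N _ uN]; exists N => // n /= Nn.
have := uN n Nn; rewrite sub0r normrN ger0_norm ?hnorm_ge0//.
by apply: le_trans; rewrite hdistC ler_dist_hnorm.
Qed.

Lemma hnorm_cvg_unique (u : nat -> H) l l' :
  hnorm (u n - l) @[n --> \oo] --> 0 -> hnorm (u n - l') @[n --> \oo] --> 0 ->
  l = l'.
Proof.
move=> ul ul'; apply/eqP; rewrite -subr_eq0 -hnorm_eq0 eq_le hnorm_ge0 andbT.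
have sum0 : hnorm (u n - l) + hnorm (u n - l') @[n --> \oo] --> (0 + 0 : R).
  exact: cvgD.
rewrite addr0 in sum0.
apply: ler_cvg_to (cvg_cst _) sum0 _ => /=; apply: nearW => n.
by rewrite (hdistC (u n)) -(subrKA (u n)) ler_hnormD.
Qed.

End hilbert_norm.

Arguments hnorm : simpl never.
Arguments rip : simpl never.
(** * Riesz representation *)

Section riesz.
Context {R : realType}.

Lemma cvg_dominated (u v : nat -> R) (l c : R) :
  (forall n, `|u n - l| <= c * v n) -> v @ \oo --> 0 -> u @ \oo --> l.
Proof.
move=> uv v0; apply/cvgrPdist_le => e e0.
have e1 : 0 < e / (`|c| + 1) by rewrite divr_gt0// ltr_wpDl.
move/cvgrPdist_le: v0 => /(_ _ e1); apply: filterS => n.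
rewrite sub0r normrN ler_pdivlMr ?ltr_wpDl// => vn.
rewrite distrC (le_trans (uv n))// (le_trans (ler_norm _))// (le_trans _ vn)//.
by rewrite normrM mulrC ler_wpM2l// lerDl.
Qed.

Context {H : hilbertType R}.

Lemma cvg_ripl (u : nat -> H) l y :
  hnorm (u n - l) @[n --> \oo] --> 0 -> rip (u n) y @[n --> \oo] --> rip l y.
Proof.
apply: cvg_dominated (hnorm y) _ => n.
by rewrite -ripNl -ripDl mulrC ler_rip.
Qed.

(** The representing vector minimises the convex functional
    [J x = |x|^2 - 2 Re (phi x)]. The parallelogram law makes minimising
    sequences Cauchy, and the first variation at the limit [y] is
    [2 (Re <h, y> - Re (phi h))], so it vanishes for all [h]; imaginary parts
    follow by replacing [h] with [- i h]. *)
Lemma riesz_representation (phi : H -> R[i]) (c : R) :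
  (forall a x y, phi (a *: x + y) = a * phi x + phi y) ->
  (forall x, cabs (phi x) <= c * hnorm x) ->
  exists y, forall x, phi x = '[x, y].
Proof.
move=> phiP phic.
pose r x := complex.Re (phi x).
have rP (t : R) x y : r (t%:C *: x + y) = t * r x + r y.
  by rewrite /r phiP raddfD /= Re_realM.
have rD x y : r (x + y) = r x + r y.
  by rewrite -[x]scale1r -(rmorph1 (real_complex R)) rP !scale1r mul1r.
have r0 : r 0 = 0 by have := rD 0 0; rewrite addr0; lra.
have rZ (t : R) x : r (t%:C *: x) = t * r x by rewrite -[_ *: _]addr0 rP r0 addr0.
have rc x : `|r x| <= c * hnorm x by rewrite (le_trans (ler_cabs_Re _)).
pose J x := hnorm x ^+ 2 - 2 * r x.
have Jge x : - c ^+ 2 <= J x.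
  have := rc x; rewrite ler_norml /J => /andP[_ rx].
  by have := sqr_ge0 (hnorm x - c); nra.
have J_inf : has_inf (range J).
  by split; [exists (J 0), 0|exists (- c ^+ 2) => _ [x _ <-]].
set m := inf (range J).
have mJ x : m <= J x by apply: (ge_inf J_inf.2); exists x.
have /choice[u uP] (n : nat) : exists x, J x < m + n.+1%:R^-1.
  have n0 : 0 < n.+1%:R^-1 :> R by rewrite invr_gt0 ltr0n.
  by have [_ [x _ <-] Jx] := inf_adherent n0 J_inf; exists x.
have dist_le x z : hnorm (x - z) ^+ 2 <= 2 * (J x - m) + 2 * (J z - m).
  have := mJ ((2^-1)%:C *: (x + z)).
  rewrite /J hnormZr ger0_norm ?invr_ge0// rZ rD exprMn hnorm_sqrD hnorm_sqrB.
  by lra.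
have [e e0|y uy] := @hnorm_cauchy_cvg _ _ u.
  have e2 : 0 < e ^+ 2 / 4 by rewrite divr_gt0 ?exprn_gt0.
  have [N _ uN] : \forall n \near \oo, n.+1%:R^-1 < e ^+ 2 / 4.
    move/cvgrPdist_lt: (@cvg_harmonic R) => /(_ _ e2); apply: filterS => n.
    by rewrite sub0r normrN => /ltr_normlW.
  exists N => i j Ni Nj.
  rewrite -ler_sqr ?nnegrE ?hnorm_ge0 ?(ltW e0)// (le_trans (dist_le _ _))//.
  have Ji : J (u i) - m < e ^+ 2 / 4.
    by rewrite ltrBlDl (lt_trans (uP i))// ltrD2l (uN _ Ni).
  have Jj : J (u j) - m < e ^+ 2 / 4.
    by rewrite ltrBlDl (lt_trans (uP j))// ltrD2l (uN _ Nj).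
  by lra.
have var (t : R) h : 0 <= 2 * t * (rip y h - r h) + t ^+ 2 * hnorm h ^+ 2.
  have low n : 0 <= 2 * t * (rip (u n) h - r h) + t ^+ 2 * hnorm h ^+ 2 + n.+1%:R^-1.
    have := mJ (u n + t%:C *: h); have := uP n.
    rewrite /J hnorm_sqrD rD rZ ripZr hnormZr exprMn -normrX ger0_norm ?sqr_ge0//.
    by move: n.+1%:R^-1 => i; lra.
  have lim : 2 * t * (rip (u n) h - r h) + t ^+ 2 * hnorm h ^+ 2 + n.+1%:R^-1
      @[n --> \oo] --> 2 * t * (rip y h - r h) + t ^+ 2 * hnorm h ^+ 2 + 0.
    apply: cvgD; last exact: cvg_harmonic.
    apply: cvgD; last exact: cvg_cst.
    apply: cvgMl_tmp; apply: cvgB; last exact: cvg_cst.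
    exact: cvg_ripl.
  rewrite addr0 in lim.
  by apply: ler_cvg_to (cvg_cst _) lim _; apply: nearW.
have rE h : r h = rip h y.
  apply/eqP; rewrite eq_sym -subr_eq0 ripC; set d := _ - _.
  have q0 : 0 < hnorm h ^+ 2 + 1 by rewrite ltr_wpDl ?sqr_ge0.
  (* With [t] of the sign opposite to [d] and small, the linear term would win
     over the quadratic one unless [d = 0]. *)
  have := var (- d / (hnorm h ^+ 2 + 1)) h; rewrite -/d.
  have -> : 2 * (- d / (hnorm h ^+ 2 + 1)) * d + (- d / (hnorm h ^+ 2 + 1)) ^+ 2 * hnorm h ^+ 2
      = - (d ^+ 2 * ((hnorm h ^+ 2 + 2) / (hnorm h ^+ 2 + 1) ^+ 2)).
    by field; rewrite gt_eqF.
  rewrite oppr_ge0 pmulr_lle0; first by rewrite -sqrf_eq0 eq_le sqr_ge0 andbT.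
  by rewrite divr_gt0 ?exprn_gt0// ltr_wpDl ?sqr_ge0.
have ReNi (a : R[i]) : complex.Re (- 'i%C * a) = complex.Im a.
  by case: a => v w /=; ring.
exists y => x; rewrite [LHS]complexE [RHS]complexE; congr (_%:C + _ * _%:C).
  exact: rE.
have := rE (- 'i%C *: x); rewrite /r /rip innerZl -[_ *: x]addr0 phiP.
have -> : phi 0 = 0 by have := phiP (-1) 0 0; rewrite scaler0 addr0 mulN1r addNr.
by rewrite addr0 !ReNi.
Qed.

End riesz.
(** * The algebra of bounded operators *)

Section bounded_operators.
Context {R : realType} {H : hilbertType R}.
Implicit Types (S T A D : 'B(H)) (x y : H) (a : R[i]).

Lemma op_linear T a x y : T (a *: x + y) = a *: T x + T y.
Proof. by have [lT _] := bounded_opP T; rewrite lT. Qed.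

Lemma opD T x y : T (x + y) = T x + T y.
Proof. by rewrite -[x]scale1r op_linear !scale1r. Qed.

Lemma op0 T : T 0 = 0.
Proof. by apply: (@addrI _ (T 0)); rewrite -opD !addr0. Qed.

Lemma opZ T a x : T (a *: x) = a *: T x.
Proof. by rewrite -[a *: x]addr0 op_linear op0 addr0. Qed.

Lemma opN T x : T (- x) = - T x.
Proof. by rewrite -scaleN1r opZ scaleN1r. Qed.

Lemma opB T x y : T (x - y) = T x - T y.
Proof. by rewrite opD opN. Qed.

Lemma eq_op S T : S =1 T -> S = T.
Proof. by move=> ST; apply: val_inj; apply/funext. Qed.

Lemma opME S T x : (S * T) x = S (T x). Proof. by []. Qed.
Lemma op1E x : (1 : 'B(H)) x = x. Proof. by []. Qed.
Lemma opDE S T x : (S + T) x = S x + T x. Proof. by []. Qed.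
Lemma opNE T x : (- T) x = - T x. Proof. by []. Qed.
Lemma opZE a T x : (a *: T) x = a *: T x. Proof. by []. Qed.
Definition opE := (opME, op1E, opDE, opNE, opZE).

Lemma op_bounded T : exists2 c : R, 0 <= c & forall x, hnorm (T x) <= c * hnorm x.
Proof.
have /asboolP[lT bT] := valP T.
pose L : {linear H -> H} := HB.pack (val T) (GRing.isLinear.Build R[i] H H *:%R (val T) lT).
have /linear_boundedP/pinfty_ex_gt0[r r0 Tr] : bounded_near L (nbhs 0) by [].
have rE : r = (complex.Re r)%:C by rewrite RRe_real// gtr0_real.
exists (complex.Re r); first by rewrite -ler0c -rE ltW.
by move=> x; rewrite -lecR rmorphM /= -rE -!hnormE; exact: Tr.
Qed.

(** The way to build an operator from a function with an explicit bound. *)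
Lemma bounded_linear_hnorm (L : H -> H) (c : R) :
  linear L -> (forall x, hnorm (L x) <= c * hnorm x) -> bounded_linear L.
Proof.
move=> lL Lc; apply/asboolP; split=> //.
pose L' : {linear H -> H} := HB.pack L (GRing.isLinear.Build R[i] H H *:%R L lL).
have -> : L = L' by [].
apply/linear_boundedP; near=> r => x.
have cr : c%:C <= r by near: r; apply: nbhs_pinfty_ge; by apply/complex_realP; exists c.
apply: (@le_trans _ _ (c%:C * `|x|)); last by rewrite ler_wpM2r.
by rewrite !hnormE -rmorphM lecR.
Unshelve. all: by end_near. Qed.

Let has_sup_opnorm T : has_sup [set complex.Re `|T x| | x in [set x : H | `|x| <= 1]].
Proof.
split; first by exists (complex.Re `|T 0|), 0 => //=; rewrite normr0.
have [c c0 Tc] := op_bounded T.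
exists c => _ [x /= x1 <-]; apply: le_trans (Tc x) _.
by rewrite ler_piMr// -lecR -hnormE.
Qed.

Lemma opnorm_ge0 T : 0 <= opnorm T.
Proof.
apply: (@le_trans _ _ (hnorm (T 0))); first exact: hnorm_ge0.
by apply: (ub_le_sup (has_sup_opnorm T).2); exists 0 => //=; rewrite normr0.
Qed.

Lemma ler_opnorm T x : hnorm (T x) <= opnorm T * hnorm x.
Proof.
have [->|x0] := eqVneq x 0; first by rewrite op0 hnorm0 mulr0.
have hx0 : 0 < hnorm x by rewrite hnorm_gt0.
rewrite -ler_pdivrMr//.
apply: (ub_le_sup (has_sup_opnorm T).2); exists ((hnorm x)^-1%:C *: x).
  by rewrite /= hnormE hnormZr gtr0_norm ?invr_gt0// mulVf ?gt_eqF.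
by rewrite opZ -[complex.Re _]/(hnorm _) hnormZr gtr0_norm ?invr_gt0// mulrC.
Qed.

Lemma opnorm_le T (c : R) : 0 <= c ->
  (forall x, hnorm (T x) <= c * hnorm x) -> opnorm T <= c.
Proof.
move=> c0 Tc; apply: ge_sup; first exact: (has_sup_opnorm T).1.
move=> _ [x /= x1 <-]; apply: le_trans (Tc x) _.
by rewrite ler_piMr// -lecR -hnormE.
Qed.

Lemma ler_opnormD S T : opnorm (S + T) <= opnorm S + opnorm T.
Proof.
apply: opnorm_le => [|x]; first by rewrite addr_ge0 ?opnorm_ge0.
by rewrite mulrDl (le_trans (ler_hnormD _ _))// lerD ?ler_opnorm.
Qed.

Lemma opnormZr (c : R) T : opnorm (c%:C *: T) <= `|c| * opnorm T.
Proof.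
apply: opnorm_le => [|x]; first by rewrite mulr_ge0 ?opnorm_ge0.
by rewrite [_ x]/(c%:C *: T x) hnormZr -mulrA ler_wpM2l ?ler_opnorm.
Qed.

Lemma opnormN T : opnorm (- T) = opnorm T.
Proof.
have le S : opnorm (- S) <= opnorm S.
  apply: opnorm_le => [|x]; first exact: opnorm_ge0.
  by rewrite [_ x]/(- S x) hnormN ler_opnorm.
by apply/eqP; rewrite eq_le le /= -{1}[T]opprK le.
Qed.

Lemma opdistC S T : opnorm (S - T) = opnorm (T - S).
Proof. by rewrite -opnormN opprB. Qed.

Lemma ler_opnormM S T : opnorm (S * T) <= opnorm S * opnorm T.
Proof.
apply: opnorm_le => [|x]; first by rewrite mulr_ge0 ?opnorm_ge0.
rewrite [_ x]/(S (T x)) (le_trans (ler_opnorm _ _))// -mulrA.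
by rewrite ler_wpM2l ?opnorm_ge0 ?ler_opnorm.
Qed.

Lemma opnorm1 : opnorm (1 : 'B(H)) <= 1.
Proof. by apply: opnorm_le => // x; rewrite mul1r. Qed.

Lemma opnormX T n : opnorm (T ^+ n) <= opnorm T ^+ n.
Proof.
elim: n => [|n IHn]; first by rewrite !expr0 opnorm1.
by rewrite !exprS (le_trans (ler_opnormM _ _))// ler_wpM2l ?opnorm_ge0.
Qed.

Lemma opnorm0 : opnorm (0 : 'B(H)) = 0.
Proof.
apply/eqP; rewrite eq_le opnorm_ge0 andbT; apply: opnorm_le => // x.
by rewrite [_ x]/(0 : H) hnorm0 mul0r.
Qed.

Lemma opnorm_eq0 T : opnorm T = 0 -> T = 0.
Proof.
move=> T0; apply: eq_op => x; apply/eqP; rewrite -hnorm_eq0 eq_le hnorm_ge0 andbT.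
by have := ler_opnorm T x; rewrite T0 mul0r.
Qed.

Lemma opZAl a S T : (a *: S) * T = a *: (S * T).
Proof. exact: eq_op. Qed.

Lemma opZAr a S T : S * (a *: T) = a *: (S * T).
Proof. by apply: eq_op => x; exact: (opZ S a (T x)). Qed.

(** Convergence in operator norm, in the form in which it occurs in the
    definition of the functional calculus. *)
Definition op_cvg (u : nat -> 'B(H)) S := opnorm (u n - S) @[n --> \oo] --> 0.

Lemma op_cvg_app u S x : op_cvg u S -> hnorm (u n x - S x) @[n --> \oo] --> 0.
Proof.
apply: cvg_dominated (hnorm x) _ => n.
by rewrite subr0 ger0_norm ?hnorm_ge0// mulrC; exact: (ler_opnorm (u n - S) x).
Qed.

Lemma cvg_opnorm u S : op_cvg u S -> opnorm (u n) @[n --> \oo] --> opnorm S.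
Proof.
apply: (@cvg_dominated _ _ _ _ 1) => n; rewrite mul1r.
have := ler_opnormD (u n - S) S; rewrite subrK.
have := ler_opnormD (S - u n) (u n); rewrite subrK opdistC.
by rewrite ler_norml => ? ?; apply/andP; split; lra.
Qed.

Lemma op_cvg_unique u S T : op_cvg u S -> op_cvg u T -> S = T.
Proof.
move=> uS uT; apply: eq_op => x.
by apply: hnorm_cvg_unique (op_cvg_app x uS) (op_cvg_app x uT).
Qed.

Lemma op_cvgM u v S T : op_cvg u S -> op_cvg v T -> op_cvg (fun n => u n * v n) (S * T).
Proof.
move=> uS vT.
have dom : opnorm (u n - S) * opnorm (v n) + opnorm S * opnorm (v n - T)
    @[n --> \oo] --> (0 : R).
  rewrite [X in _ --> X](_ : 0 = 0 * opnorm T + opnorm S * 0); last by ring.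
  by apply: cvgD; apply: cvgM => //; [exact: cvg_opnorm|exact: cvg_cst].
apply: (@cvg_dominated _ _ _ _ 1) dom => n.
rewrite subr0 ger0_norm ?opnorm_ge0// mul1r.
have -> : u n * v n - S * T = (u n - S) * v n + S * (v n - T).
  by rewrite mulrBl mulrBr addrA subrK.
by rewrite (le_trans (ler_opnormD _ _))// lerD ?ler_opnormM.
Qed.

Lemma op_cvg_cst S : op_cvg (fun=> S) S.
Proof. by rewrite /op_cvg subrr opnorm0; exact: cvg_cst. Qed.

(** A Cauchy sequence of operators converges at each vector since [H] is
    complete; the pointwise limit is linear, and the Cauchy estimate passes to
    the limit uniformly on the unit ball. *)
Lemma op_complete (u : nat -> 'B(H)) :
  (forall e : R, 0 < e -> exists N, forall m n, (N <= m)%N -> (N <= n)%N ->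
     opnorm (u m - u n) <= e) ->
  exists S, op_cvg u S.
Proof.
move=> uc.
have /choice[l ul] x : exists l, hnorm (u n x - l) @[n --> \oo] --> 0.
  apply: hnorm_cauchy_cvg => e e0.
  have x1 : 0 < hnorm x + 1 by rewrite ltr_wpDl ?hnorm_ge0.
  have [|N uN] := uc (e / (hnorm x + 1)); first by rewrite divr_gt0.
  exists N => m n Nm Nn; apply: (le_trans (ler_opnorm (u m - u n) x)).
  apply: le_trans (ler_wpM2r (hnorm_ge0 x) (uN _ _ Nm Nn)) _.
  by rewrite mulrAC ler_pdivrMr// ler_wpM2l ?(ltW e0)// lerDl.
have lin : linear l.
  move=> a x y; apply: hnorm_cvg_unique (ul _) _.
  have sum0 : cabs a * hnorm (u n x - l x) + 1 * hnorm (u n y - l y)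
      @[n --> \oo] --> (cabs a * 0 + 1 * 0 : R).
    by apply: cvgD; apply: cvgMl_tmp; exact: ul.
  rewrite !mulr0 addr0 in sum0.
  apply: (@cvg_dominated _ _ _ _ 1) sum0 => n.
  rewrite subr0 ger0_norm ?hnorm_ge0// !mul1r op_linear opprD addrACA -scalerBr -hnormZ.
  exact: ler_hnormD.
have unif (e : R) N : (forall m n, (N <= m)%N -> (N <= n)%N -> opnorm (u m - u n) <= e) ->
    forall n x, (N <= n)%N -> hnorm (u n x - l x) <= e * hnorm x.
  move=> uN n x Nn.
  have lim : hnorm (u m x - u n x) @[m --> \oo] --> hnorm (l x - u n x).
    apply: cvg_hnorm; apply: cvg_trans (ul x); apply: near_eq_cvg; apply: nearW => m.
    by rewrite opprB addrA subrK.
  rewrite hdistC; apply: ler_cvg_to lim (cvg_cst _) _.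
  exists N => // m /= Nm; apply: le_trans (ler_opnorm (u m - u n) x) _.
  by rewrite ler_wpM2r ?hnorm_ge0 ?uN.
have [N1 uN1] := uc 1 ltr01.
have bl : bounded_linear l.
  apply: (@bounded_linear_hnorm _ (1 + opnorm (u N1))) => // x.
  rewrite -[l x](subrK (u N1 x)) (le_trans (ler_hnormD _ _))// mulrDl lerD ?ler_opnorm//.
  by rewrite hdistC (unif _ N1).
exists (BoundedOp bl); apply/cvgrPdist_le => e e0.
have [N uN] := uc e e0; exists N => // n /= Nn.
rewrite sub0r normrN ger0_norm ?opnorm_ge0//; apply: opnorm_le (ltW e0) _ => x.
exact: (unif _ N).
Qed.

End bounded_operators.
(** * Adjoints, positive operators and their spectrum *)

Section adjoint_spectrum.
Context {R : realType} {H : hilbertType R}.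
Implicit Types (S T A D : 'B(H)) (x y : H) (a : R[i]).

(** The adjoint is picked by choice, so its existence has to be proved: Riesz
    representation of [x |-> <T x, y>] gives its value at [y], and
    [|S y|^2 = <T (S y), y>] bounds it. *)
Lemma inner_adjointr T x y : '[T x, y] = '[x, adjoint T y].
Proof.
rewrite /adjoint; move: x y; case: xgetP => [S _ //|nex].
have /choice[S TS] y : exists z, forall x, '[T x, y] = '[x, z].
  apply: (@riesz_representation _ _ _ (opnorm T * hnorm y)) => [a x x'|x].
    by rewrite op_linear linearPl.
  rewrite mulrAC (le_trans (cauchy_schwarz _ _))// ler_wpM2r ?hnorm_ge0//.
  exact: ler_opnorm.
have lS : linear S.
  move=> a x y; apply/eqP; rewrite -subr_eq0 -(dnorm_eq0 (@inner R H)); apply/eqP.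
  set d := (X in '[X, X]); rewrite {2}/d linearBr linearPr /= -!TS.
  by rewrite linearPr /= subrr.
have bS : bounded_linear S.
  apply: (@bounded_linear_hnorm _ _ _ (opnorm T)) => // y.
  have [->|Sy0] := eqVneq (S y) 0; first by rewrite hnorm0 mulr_ge0 ?opnorm_ge0 ?hnorm_ge0.
  have hS0 : 0 < hnorm (S y) by rewrite hnorm_gt0.
  rewrite -(ler_pM2r hS0) -expr2 hnorm_sqr /rip -TS (le_trans (ler_norm _))//.
  rewrite (le_trans (ler_rip _ _))// mulrAC ler_wpM2r ?hnorm_ge0//.
  exact: ler_opnorm.
by case: (nex (BoundedOp bS)) => x y /=; exact: TS.
Qed.

Lemma adjoint_innerl T x y : '[adjoint T x, y] = '[x, T y].
Proof. by rewrite innerC -inner_adjointr -innerC. Qed.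

Lemma ler_opnorm_adjoint T : opnorm (adjoint T) <= opnorm T.
Proof.
apply: opnorm_le => [|y]; first exact: opnorm_ge0.
have [S0|S0] := eqVneq (hnorm (adjoint T y)) 0.
  by rewrite S0 mulr_ge0 ?opnorm_ge0 ?hnorm_ge0.
have hS0 : 0 < hnorm (adjoint T y) by rewrite lt_neqAle eq_sym S0 hnorm_ge0.
rewrite -(ler_pM2r hS0) -expr2 hnorm_sqr /rip -inner_adjointr (le_trans (ler_norm _))//.
rewrite (le_trans (ler_rip _ _))// mulrAC ler_wpM2r ?hnorm_ge0//.
exact: ler_opnorm.
Qed.

Lemma adjointK T : adjoint (adjoint T) = T.
Proof.
apply: eq_op => x; apply/eqP; rewrite -subr_eq0 -(dnorm_eq0 (@inner R H)); apply/eqP.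
by set d := (X in '[X, X]); rewrite {2}/d linearBr /= -inner_adjointr adjoint_innerl subrr.
Qed.

Lemma opnorm_adjoint T : opnorm (adjoint T) = opnorm T.
Proof.
apply/eqP; rewrite eq_le ler_opnorm_adjoint /=.
by rewrite -[in leLHS](adjointK T) ler_opnorm_adjoint.
Qed.

Definition self_adjoint A := forall x y, '[A x, y] = '[x, A y].

Definition positive_op A := self_adjoint A /\ forall x, 0 <= rip (A x) x.

Lemma rip_self_adjoint A x y : self_adjoint A -> rip (A x) y = rip x (A y).
Proof. by rewrite /rip => ->. Qed.

Lemma positive_adjointM T : positive_op (adjoint T * T).
Proof.
split=> [x y|x].
  by rewrite !opME adjoint_innerl inner_adjointr.
rewrite !opME /rip adjoint_innerl -/(rip _ _).
by rewrite -hnorm_sqr sqr_ge0.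
Qed.

(** The partial sums [u n] of the Neumann series satisfy
    [(1 - D) u n = 1 - D^n]. As [1 - D] is bounded below by [1 - |D|], this
    identity yields both the Cauchy property of [u] and the inverse. *)
Lemma neumann_inverse D : opnorm D < 1 ->
  exists S, S * (1 - D) = 1 /\ (1 - D) * S = 1.
Proof.
move=> D1; set q := opnorm D in D1.
have q0 : 0 <= q by exact: opnorm_ge0.
pose u n := \sum_(i < n) D ^+ i.
have uD n : (1 - D) * u n = 1 - D ^+ n.
  by rewrite -(opprB D) mulNr -subrX1 opprB.
have Du n : u n * (1 - D) = 1 - D ^+ n.
  rewrite -uD; apply: commr_sym; apply: commr_sum => i _; apply: commrX.
  by apply: commr_sym; apply: commrB; [exact: commr1|].
have q1 : 0 < 1 - q by rewrite subr_gt0.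
have below x : (1 - q) * hnorm x <= hnorm ((1 - D) x).
  have := ler_opnorm D x; have := ler_hnormD ((1 - D) x) (D x).
  by rewrite !opE subrK -/q; lra.
have qn0 : q ^+ n @[n --> \oo] --> (0 : R).
  by apply: cvg_expr; rewrite ger0_norm.
have Dn0 : op_cvg (fun n => 1 - D ^+ n) 1.
  apply: (@cvg_dominated _ _ _ _ 1) qn0 => n.
  rewrite subr0 ger0_norm ?opnorm_ge0// mul1r opdistC opprB addrC subrK.
  exact: opnormX.
have [|S uS] := @op_complete _ _ u.
  move=> e e0.
  have e1 : 0 < e * (1 - q) / 2 by rewrite divr_gt0 ?mulr_gt0.
  move/cvgrPdist_le: qn0 => /(_ _ e1)[N _ qN]; exists N => m n Nm Nn.
  apply: opnorm_le (ltW e0) _ => x; rewrite -(ler_pM2l q1) (le_trans (below _))//.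
  have -> : (1 - D) ((u m - u n) x) = (D ^+ n - D ^+ m) x.
    by rewrite -opME mulrBr !uD opprB addrC addrA subrK.
  rewrite (le_trans (ler_opnorm _ _))// mulrA ler_wpM2r ?hnorm_ge0//.
  have Dk k : (N <= k)%N -> opnorm (D ^+ k) <= e * (1 - q) / 2.
    move=> Nk; rewrite (le_trans (opnormX _ _))//.
    by have := qN k Nk; rewrite sub0r normrN; apply: le_trans; exact: ler_norm.
  rewrite (le_trans (ler_opnormD _ _))// opnormN.
  by have := Dk m Nm; have := Dk n Nn; lra.
exists S; split.
  apply: op_cvg_unique Dn0; rewrite -(funext Du).
  by apply: op_cvgM => //; exact: op_cvg_cst.
apply: op_cvg_unique Dn0; rewrite -(funext uD).
by apply: op_cvgM => //; exact: op_cvg_cst.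
Qed.

(** Otherwise [t - A = (t - c) (1 - (A - c) / (t - c))] would be invertible by
    the Neumann series. *)
Lemma spectrum_disc A (c t : R) :
  spectrum A t%:C -> `|t - c| <= opnorm (A - c%:C *: (1 : 'B(H))).
Proof.
move=> At; rewrite leNgt; apply/negP => lt; apply: At.
have s0 : t - c != 0.
  by apply: contraTneq lt => ->; rewrite normr0 -leNgt opnorm_ge0.
have sV a : a = (t - c)%:C * ((t - c)^-1%:C * a).
  by rewrite mulrA -rmorphM /= mulfV// mul1r.
set s := t - c in lt s0 sV.
have [|S [S1 S2]] := @neumann_inverse (s^-1%:C *: (A - c%:C *: (1 : 'B(H)))).
  rewrite (le_lt_trans (opnormZr _ _))// normfV ltr_pdivrMl ?normr_gt0// mulr1.
  exact: lt.
have tA : t%:C *: (1 : 'B(H)) - A = s%:C *: ((1 : 'B(H)) - s^-1%:C *: (A - c%:C *: (1 : 'B(H)))).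
  rewrite scalerBr scalerA -rmorphM /= mulfV// scale1r opprB addrA -scalerDl.
  by rewrite -rmorphD /= subrK.
exists (s^-1%:C *: S); rewrite tA !opZAl !opZAr S1 S2.
by rewrite !scalerA -!rmorphM /= mulfV// mulVf// scale1r.
Qed.

(** The Cauchy-Schwarz inequality of the semi-inner product [<A x, y>], obtained
    by evaluating the quadratic form of [A] at [x - A x / |A|]. *)
Lemma positive_hnorm_sqr A x : positive_op A ->
  hnorm (A x) ^+ 2 <= opnorm A * rip (A x) x.
Proof.
move=> [sA A0]; set M := opnorm A.
have [M0|M0] := eqVneq M 0.
  by rewrite (opnorm_eq0 M0) /rip /= linear0l mulr0 hnorm0 expr0n.
have M_gt0 : 0 < M by rewrite lt_neqAle eq_sym M0 opnorm_ge0.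
have := A0 (x - (M^-1)%:C *: A x).
rewrite !opB !opZ !ripE (rip_self_adjoint (A x) x sA) -!hnorm_sqr.
have le : rip (A (A x)) (A x) <= M * hnorm (A x) ^+ 2.
  rewrite (le_trans (ler_norm _))// (le_trans (ler_rip _ _))// expr2 mulrA.
  by rewrite ler_wpM2r ?hnorm_ge0 ?ler_opnorm.
have le' : M^-1 * rip (A (A x)) (A x) <= hnorm (A x) ^+ 2 by rewrite ler_pdivrMl.
have le2 : M^-1 * (M^-1 * rip (A (A x)) (A x)) <= M^-1 * hnorm (A x) ^+ 2.
  by rewrite ler_pM2l ?invr_gt0.
by move=> ge; rewrite -ler_pdivrMl//; lra.
Qed.

(** If [0 <= A <= M] then [|A - M/2| <= M/2], and the disc of centre [M/2] and
    radius [M/2] meets the real line in [0, M]. *)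
Lemma positive_spectrum A (t : R) :
  positive_op A -> spectrum A t%:C -> 0 <= t <= opnorm A.
Proof.
move=> pA /(@spectrum_disc _ (opnorm A / 2)) tA.
have : `|t - opnorm A / 2| <= opnorm A / 2.
  apply: le_trans tA _; apply: opnorm_le => [|x]; first by rewrite divr_ge0 ?opnorm_ge0.
  rewrite -ler_sqr ?nnegrE ?mulr_ge0 ?invr_ge0 ?opnorm_ge0 ?hnorm_ge0//.
  rewrite !opE hnorm_sqrB ripZr hnormZr !exprMn -normrX ger0_norm ?sqr_ge0//.
  by have := positive_hnorm_sqr x pA; lra.
by rewrite ler_norml => /andP[? ?]; apply/andP; split; lra.
Qed.

End adjoint_spectrum.
(** * Polynomials in a self-adjoint operator *)

Section polynomial_calculus.
Context {R : realType} {H : hilbertType R}.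
Local Notation C := R[i].
Implicit Types (S T A B : 'B(H)) (x y : H) (a z : C).

(** The failure of this property for [A - z] says that [z] is an approximate
    eigenvalue of [A]. For self-adjoint operators approximate eigenvalues exhaust
    the spectrum, and they are easier to produce and to use. *)
Definition bounded_below S := exists2 c : R, 0 < c & forall x, c * hnorm x <= hnorm (S x).

Lemma bounded_belowM S T : bounded_below S -> bounded_below T -> bounded_below (S * T).
Proof.
move=> [c c0 Sc] [d d0 Td]; exists (c * d); first exact: mulr_gt0.
by move=> x; rewrite -mulrA opME (le_trans _ (Sc _))// ler_pM2l.
Qed.

Lemma bounded_belowM_right S T : bounded_below (S * T) -> bounded_below T.
Proof.
move=> [c c0 STc]; have S0 : 0 < opnorm S + 1 by rewrite ltr_wpDl ?opnorm_ge0.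
exists (c / (opnorm S + 1)); first exact: divr_gt0.
move=> x; rewrite mulrAC ler_pdivrMr// (le_trans (STc x))// opME.
rewrite (le_trans (ler_opnorm _ _))// mulrC ler_wpM2l ?hnorm_ge0//.
by rewrite lerDl.
Qed.

Lemma bounded_below_scalar a : a != 0 -> bounded_below (a *: (1 : 'B(H))).
Proof.
move=> a0; exists (cabs a); last by move=> x; rewrite !opE hnormZ.
by rewrite -ltcR -cabsE normr_gt0.
Qed.

Lemma bounded_belowN S : bounded_below S -> bounded_below (- S).
Proof. by move=> [c c0 Sc]; exists c => // x; rewrite opNE hnormN. Qed.

Lemma not_bounded_below_spectrum A z :
  ~ bounded_below (A - z *: (1 : 'B(H))) -> spectrum A z.
Proof.
move=> nb [S [S1 _]]; apply: nb; rewrite -(opprB _ A); apply: bounded_belowN.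
apply: (@bounded_belowM_right S); rewrite S1 -[1]scale1r.
by apply: bounded_below_scalar; exact: oner_neq0.
Qed.

Lemma ler_cabs_Im a : `|complex.Im a| <= cabs a.
Proof.
have := ler_cabs_Re ('i%C * a).
have -> : cabs ('i%C * a) = cabs a.
  rewrite /cabs normrM (_ : `|'i%C| = 1) ?mul1r//.
  by rewrite normc_def /= expr0n expr1n add0r sqrtr1.
by rewrite mulrC ReiNIm normrN.
Qed.

(** [<A x, x>] is real, so the imaginary part of [<(A - z) x, x>] is
    [- Im z |x|^2]. *)
Lemma self_adjoint_bounded_below A z :
  self_adjoint A -> complex.Im z != 0 -> bounded_below (A - z *: (1 : 'B(H))).
Proof.
move=> sA z0; exists `|complex.Im z|; first by rewrite normr_gt0.
move=> x; have [->|x0] := eqVneq x 0; first by rewrite hnorm0 mulr0 hnorm_ge0.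
have hx0 : 0 < hnorm x by rewrite hnorm_gt0.
rewrite -(ler_pM2r hx0); apply: le_trans (cauchy_schwarz _ _).
apply: le_trans (ler_cabs_Im _).
have Im0 : complex.Im '[A x, x] = 0.
  have : complex.Im '[A x, x] = complex.Im (Num.conj '[A x, x]) by rewrite -innerC sA.
  by case: '[A x, x] => u v /=; lra.
rewrite !opE linearBl /= raddfB /= Im0 sub0r normrN innerZl innerE hnormE.
rewrite -rmorphXn; case: z {z0 Im0} => u v /=.
by rewrite mulr0 add0r normrM [X in _ <= _ * X]ger0_norm ?sqr_ge0// expr2 mulrA.
Qed.

(** Complex coefficients are needed to split a real polynomial into linear
    factors. *)
Definition cpoly (p : {poly C}) T : 'B(H) := \sum_(k < size p) p`_k *: T ^+ k.

Lemma cpoly_widen n (p : {poly C}) T : (size p <= n)%N ->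
  cpoly p T = \sum_(k < n) p`_k *: T ^+ k.
Proof.
move=> pn; rewrite /cpoly (big_ord_widen n (fun k => p`_k *: T ^+ k))// big_mkcond.
apply: eq_bigr => k _; case: ltnP => // pk.
by rewrite nth_default// scale0r.
Qed.

Lemma cpolyD p q T : cpoly (p + q) T = cpoly p T + cpoly q T.
Proof.
have := size_polyD p q; set n := maxn _ _ => pqn.
rewrite !(@cpoly_widen n) ?leq_maxl ?leq_maxr// -big_split.
by apply: eq_bigr => k _; rewrite coefD scalerDl.
Qed.

Lemma cpolyZ a p T : cpoly (a *: p) T = a *: cpoly p T.
Proof.
rewrite (@cpoly_widen (size p)) ?size_scale_leq// scaler_sumr.
by apply: eq_bigr => k _; rewrite coefZ scalerA.
Qed.

Lemma cpolyC a T : cpoly a%:P T = a *: (1 : 'B(H)).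
Proof. by rewrite (@cpoly_widen 1) ?size_polyC_leq1// big_ord1 coefC. Qed.

Lemma cpolyMX p T : cpoly (p * 'X) T = cpoly p T * T.
Proof.
rewrite (@cpoly_widen (size p).+1); last first.
  by have := size_polyMleq p 'X; rewrite size_polyX addn2.
rewrite big_ord_recl coefMX /= scale0r add0r mulr_suml.
by apply: eq_bigr => k _; rewrite coefMX /= opZAl -exprSr.
Qed.

Lemma cpolyM p q T : cpoly (p * q) T = cpoly p T * cpoly q T.
Proof.
elim/poly_ind: q => [|q c IHq].
  by rewrite mulr0 /cpoly size_poly0 big_ord0 mulr0.
rewrite mulrDr mulrA cpolyD cpolyMX IHq mulrC mul_polyC cpolyZ.
by rewrite cpolyD cpolyMX cpolyC mulrDr opZAr mulr1 mulrA.
Qed.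

Lemma op_polyE p T : op_poly p T = cpoly (map_poly (real_complex R) p) T.
Proof.
rewrite /op_poly /cpoly size_map_poly.
by apply: eq_bigr => k _; rewrite coef_map.
Qed.

Lemma op_polyD p q T : op_poly (p + q) T = op_poly p T + op_poly q T.
Proof. by rewrite !op_polyE rmorphD cpolyD. Qed.

Lemma op_polyC c T : op_poly c%:P T = c%:C *: (1 : 'B(H)).
Proof. by rewrite !op_polyE map_polyC cpolyC. Qed.

Lemma op_polyM p q T : op_poly (p * q) T = op_poly p T * op_poly q T.
Proof. by rewrite !op_polyE rmorphM cpolyM. Qed.

Lemma op_polyN p T : op_poly (- p) T = - op_poly p T.
Proof.
rewrite -mulN1r -[-1](polyCN 1) op_polyM op_polyC.
by rewrite rmorphN rmorph1 scaleN1r mulN1r.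
Qed.

Lemma op_polyB p q T : op_poly (p - q) T = op_poly p T - op_poly q T.
Proof. by rewrite op_polyD op_polyN. Qed.

Lemma op_polyX T : op_poly 'X T = T.
Proof. by rewrite op_polyE map_polyX -['X]mul1r cpolyMX -[1%R]/(1%:P) cpolyC scale1r mul1r. Qed.

Lemma self_adjoint_op_poly p A : self_adjoint A -> self_adjoint (op_poly p A).
Proof.
move=> sA.
have sX k : self_adjoint (A ^+ k).
  elim: k => [|k IHk] x y; first by rewrite expr0.
  by rewrite {1}exprS exprSr !opME sA IHk.
have conjr (c : R) : Num.conj c%:C = c%:C by rewrite conj_Creal// complex_real.
rewrite /op_poly; elim/big_ind: _ => [x y|S T sS sT x y|k _ x y].
- by rewrite [LHS]linear0l [RHS]linear0r.
- by rewrite !opDE linearDl linearDr /= sS sT.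
- by rewrite !opZE innerZl innerZr sX conjr.
Qed.

(** Split [q] over the complex numbers. If no real root of [q] were in the
    spectrum, then all factors [A - z] would be bounded below, the non-real ones
    because [A] is self-adjoint, and so would be their product. *)
Lemma root_spectrum q A : self_adjoint A -> q != 0 -> ~ bounded_below (op_poly q A) ->
  exists2 t : R, spectrum A t%:C & root q t.
Proof.
move=> sA q0; apply: contra_notP => nt.
rewrite op_polyE; set qC := map_poly _ q.
have qC0 : lead_coef qC != 0 by rewrite lead_coef_eq0 map_poly_eq0.
have [rs qE] := closed_field_poly_normal qC.
have bb z : z \in rs -> bounded_below (A - z *: (1 : 'B(H))).
  move=> zrs; have [z0|] := eqVneq (complex.Im z) 0; last exact: self_adjoint_bounded_below.
  apply: contra_notP nt => /not_bounded_below_spectrum zA.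
  have zE : z = (complex.Re z)%:C by case: z z0 {zrs zA} => u v /= ->.
  exists (complex.Re z); first by rewrite -zE.
  have : root qC z by rewrite qE rootZ// root_prod_XsubC.
  by rewrite zE /qC fmorph_root.
rewrite qE cpolyZ -[cpoly _ _]mul1r -opZAl; apply: bounded_belowM.
  exact: bounded_below_scalar.
elim: rs bb {qE} => [|z rs IHrs] bb.
  rewrite big_nil -[1%R]/(1%:P) cpolyC; apply: bounded_below_scalar; exact: oner_neq0.
rewrite big_cons cpolyM; apply: bounded_belowM; last first.
  by apply: IHrs => w wrs; apply: bb; rewrite inE wrs orbT.
rewrite cpolyD -polyCN cpolyC scaleNr -['X]mul1r cpolyMX -[1%R]/(1%:P) cpolyC scale1r mul1r.
by apply: bb; rewrite mem_head.
Qed.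

(** One of [|B|] and [- |B|] is an approximate eigenvalue of [B]. With
    [N = |B|], expanding the square gives
    [|(B^2 - N^2) x|^2 <= N^4 |x|^2 - N^2 |B x|^2], so a lower bound [c |x|] of
    [|(B^2 - N^2) x|] would improve [|B x| <= N |x|]. *)
Lemma self_adjoint_sqr_not_bounded_below B : self_adjoint B -> 0 < opnorm B ->
  ~ bounded_below (B * B - (opnorm B ^+ 2)%:C *: (1 : 'B(H))).
Proof.
move=> sB; set N := opnorm B => N0 [c c0 Bc].
(* [Num.sqrt k] is the improved bound. A negative [k] has root 0, so its sign
   need not be known in advance. *)
pose k := N ^+ 2 - c ^+ 2 / N ^+ 2.
have N2 : 0 < N ^+ 2 by rewrite exprn_gt0.
have Bk x : hnorm (B x) ^+ 2 <= k * hnorm x ^+ 2.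
  have := Bc x; rewrite -ler_sqr ?nnegrE ?mulr_ge0 ?hnorm_ge0 ?(ltW c0)//.
  rewrite !opE hnorm_sqrB ripZr hnormZr (rip_self_adjoint (B x) x sB) -hnorm_sqr.
  rewrite !exprMn -normrX ger0_norm ?sqr_ge0// => le.
  have le2 : hnorm (B (B x)) ^+ 2 <= N ^+ 2 * hnorm (B x) ^+ 2.
    by rewrite -exprMn ler_sqr ?nnegrE ?mulr_ge0 ?hnorm_ge0 ?opnorm_ge0// ler_opnorm.
  rewrite -(ler_pM2l N2).
  have -> : N ^+ 2 * (k * hnorm x ^+ 2) = (N ^+ 2) ^+ 2 * hnorm x ^+ 2 - c ^+ 2 * hnorm x ^+ 2.
    by rewrite /k; field; rewrite gt_eqF.
  by lra.
have : N <= Num.sqrt k.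
  apply: opnorm_le => [|x]; first exact: sqrtr_ge0.
  have rhs0 : 0 <= Num.sqrt k * hnorm x by rewrite mulr_ge0 ?sqrtr_ge0 ?hnorm_ge0.
  rewrite -ler_sqr ?nnegrE ?hnorm_ge0// exprMn (le_trans (Bk x))//.
  rewrite ler_wpM2r ?sqr_ge0//.
  have [k0|/ltW k0] := leP 0 k; first by rewrite sqr_sqrtr.
  exact: le_trans k0 (sqr_ge0 _).
have k_lt : k < N ^+ 2 by rewrite gtrBl divr_gt0 ?exprn_gt0.
move=> Nk; suff : Num.sqrt k < N by rewrite ltNge Nk.
by rewrite -[ltRHS]ger0_norm ?opnorm_ge0// -sqrtr_sqr ltr_sqrt.
Qed.

(** Apply [root_spectrum] to [X^2 - |A|^2], unless [A = 0]. *)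
Lemma spectrum_nonempty A : self_adjoint A -> 0 < opnorm (1 : 'B(H)) ->
  exists t : R, spectrum A t%:C.
Proof.
move=> sA H0; have [A0|A0] := eqVneq (opnorm A) 0.
  exists 0; apply: not_bounded_below_spectrum.
  rewrite (opnorm_eq0 A0) scale0r subrr => -[c c0 c0x].
  suff E : (1 : 'B(H)) = 0 by rewrite E opnorm0 ltxx in H0.
  apply: eq_op => x; apply/eqP; rewrite -[_ == _]/(x == 0) -hnorm_eq0 eq_le hnorm_ge0 andbT.
  by have := c0x x; rewrite [X in _ <= hnorm X]/(0 : H) hnorm0 pmulr_rle0.
have A_gt0 : 0 < opnorm A by rewrite lt_neqAle eq_sym A0 opnorm_ge0.
have q0 : 'X ^+ 2 - (opnorm A ^+ 2)%:P != 0 :> {poly R}.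
  by rewrite -size_poly_eq0 size_XnsubC.
have [|t tA _] := root_spectrum sA q0; last by exists t.
rewrite op_polyB op_polyC expr2 op_polyM op_polyX.
exact: self_adjoint_sqr_not_bounded_below.
Qed.

(** With [B = p(A)] and [N = |B|], the polynomial [p^2 - N^2] has a root [t] in
    the spectrum of [A], that is, [|p(t)| = N]: the norm is attained. *)
Lemma opnorm_poly_le A p (e : R) : self_adjoint A -> 0 <= e ->
  (forall t : R, spectrum A t%:C -> `|p.[t]| <= e) -> opnorm (op_poly p A) <= e.
Proof.
move=> sA e0 pe; rewrite leNgt; apply/negP => lt.
set B := op_poly p A in lt; have N0 : 0 < opnorm B by exact: le_lt_trans lt.
have H0 : 0 < opnorm (1 : 'B(H)).
  rewrite lt_neqAle opnorm_ge0 andbT eq_sym; apply: contraTneq N0 => /opnorm_eq0 H0.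
  by rewrite -[B]mulr1 H0 mulr0 opnorm0 ltxx.
pose q := p * p - (opnorm B ^+ 2)%:P.
have qB : ~ bounded_below (op_poly q A).
  rewrite op_polyB op_polyC op_polyM.
  by apply: self_adjoint_sqr_not_bounded_below => //; exact: self_adjoint_op_poly.
have [t tA qt] : exists2 t : R, spectrum A t%:C & root q t.
  (* Here [p] is the constant [N] or [- N], and any point of the spectrum will do. *)
  have [q0|q0] := eqVneq q 0; last exact: root_spectrum.
  by have [t tA] := spectrum_nonempty sA H0; exists t; rewrite // q0 root0.
have : p.[t] ^+ 2 = opnorm B ^+ 2.
  by move: qt; rewrite /root /q !hornerE subr_eq0 -expr2 => /eqP.
move/(congr1 Num.sqrt); rewrite !sqrtr_sqr [RHS]gtr0_norm// => ptE.
by have := pe t tA; rewrite ptE leNgt lt.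
Qed.

(** Write [p - p(t) = r ('X - t)]. If [|p(A)|] were less than [|p(t)|], then
    [p(A) - p(t) = r(A) (A - t)] would be bounded below, hence also [A - t]. *)
Lemma ler_opnorm_poly A p (t : R) :
  ~ bounded_below (A - t%:C *: (1 : 'B(H))) -> `|p.[t]| <= opnorm (op_poly p A).
Proof.
apply: contra_notP => /negP; rewrite -ltNge; set N := opnorm _ => lt.
have /factor_theorem[r rE] : root (p - p.[t]%:P) t.
  by rewrite /root !hornerE subrr.
have : bounded_below (op_poly (p - p.[t]%:P) A).
  exists (`|p.[t]| - N); first by rewrite subr_gt0.
  move=> x; rewrite op_polyB op_polyC !opE.
  have := ler_hnormD (p.[t]%:C *: x - op_poly p A x) (op_poly p A x).
  rewrite subrK hnormZr hdistC; have := ler_opnorm (op_poly p A) x; rewrite -/N.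
  lra.
by rewrite rE op_polyM op_polyB op_polyX op_polyC => /bounded_belowM_right.
Qed.

(** [A^2 - M^2 = (A + M) (A - M)] where [A + M] is bounded below by [M], so the
    approximate eigenvalue of [A] provided by its norm is [M] and not [- M]. *)
Lemma positive_opnorm_spectrum A : positive_op A -> 0 < opnorm A ->
  ~ bounded_below (A - (opnorm A)%:C *: (1 : 'B(H))).
Proof.
move=> [sA A0] M0 bA; apply: (self_adjoint_sqr_not_bounded_below sA M0).
set M := opnorm A.
have -> : A * A - (M ^+ 2)%:C *: (1 : 'B(H)) =
    (A + M%:C *: (1 : 'B(H))) * (A - M%:C *: (1 : 'B(H))).
  rewrite mulrDl !mulrBr !opZAl !opZAr !mul1r mulr1 scalerA expr2 rmorphM /=.
  by rewrite addrA subrK.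
apply: bounded_belowM => //; exists M => // x.
have [->|x0] := eqVneq x 0; first by rewrite hnorm0 mulr0 hnorm_ge0.
have hx0 : 0 < hnorm x by rewrite hnorm_gt0.
rewrite -(ler_pM2r hx0).
apply: le_trans (le_trans (ler_norm _) (ler_rip _ _)).
rewrite !opE ripDl ripZl -hnorm_sqr expr2 mulrA lerDr.
exact: A0.
Qed.

End polynomial_calculus.
(** * Continuous functions of a positive operator *)

Section continuous_calculus.
Context {R : realType}.

Lemma uniform_cvgP (D : set R) (u : nat -> R -> R) (f : R -> R) :
  {uniform D, u @ \oo --> f} <->
  forall e : R, 0 < e -> \forall k \near \oo, forall t, D t -> `|u k t - f t| < e.
Proof.
split=> [uf e e0|uf P /uniform_nbhs[E [entE EP]]].
  apply: (uf [set h : R -> R | forall t, D t -> `|h t - f t| < e]).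
  apply/uniform_nbhs; exists [set xy | ball xy.1 e xy.2]; split.
    by rewrite -entourage_ballE; exists e.
  by move=> h /= hE t /hE; rewrite -ball_normE /= distrC.
have [e /= e0 eE] : exists2 e : R, 0 < e & [set xy : R * R | ball xy.1 e xy.2] `<=` E.
  by move: entE; rewrite -entourage_ballE => -[e e0 eE]; exists e.
rewrite nbhs_filterE /fmap /=; apply: filterS (uf e e0) => k uk; apply: EP => t Dt.
by apply: eE; rewrite /= -ball_normE /= distrC; exact: uk.
Qed.

Lemma continuous_segment (f : R -> R) (b : R) :
  {within `[0, +oo[%classic, continuous f} -> {within `[0, b], continuous f}.
Proof.
apply: continuous_subspaceW => t /=.
by rewrite !in_itv /= andbT => /andP[].
Qed.

Context {H : hilbertType R}.
Implicit Types (S T A B : 'B(H)) (x y : H).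

(** The defining property of [cfc f A]. The results below hold for any such [S],
    so they do not depend on the uniqueness of the limit. *)
Definition is_cfc (f : R -> R) A S := exists p : nat -> {poly R},
  {uniform [set t : R | spectrum A t%:C], (fun k t => (p k).[t]) @ \oo --> f} /\
  op_cvg (fun k => op_poly (p k) A) S.

(** Weierstrass polynomials for [f] on a segment that contains the spectrum have
    uniformly close values there, so their values at [A] form a Cauchy
    sequence. *)
Lemma cfcP (f : R -> R) A : positive_op A ->
  {within `[0, +oo[%classic, continuous f} -> is_cfc f A (cfc f A).
Proof.
move=> pA cf; rewrite /cfc; case: xgetP => [S _ //|nex]; exfalso.
(* The segment is [0, |A| + 1] because [A] may be zero. *)
have M0 : 0 < opnorm A + 1 by rewrite ltr_wpDl ?opnorm_ge0.
have /choice[p pP] (k : nat) : exists p : {poly R},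
    forall t, 0 <= t <= opnorm A + 1 -> `|p.[t] - f t| < k.+1%:R^-1.
  by apply: weierstrass => //; exact: continuous_segment.
have pf : {uniform [set t : R | spectrum A t%:C], (fun k t => (p k).[t]) @ \oo --> f}.
  apply/uniform_cvgP => e e0.
  move/cvgrPdist_lt: (@cvg_harmonic R) => /(_ _ e0); apply: filterS => k.
  rewrite sub0r normrN => /ltr_normlW ke t /(positive_spectrum pA)/andP[t0 tM].
  rewrite (lt_trans _ ke)// pP// t0 /=.
  by rewrite (le_trans tM)// lerDl.
have [|S pS] := @op_complete _ _ (fun k => op_poly (p k) A); last first.
  by apply: (nex S); exists p.
move=> e e0; have e2 : 0 < e / 2 by rewrite divr_gt0.
move/uniform_cvgP: pf => /(_ _ e2)[N _ pN]; exists N => m n Nm Nn.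
rewrite -op_polyB; apply: opnorm_poly_le (ltW e0) _; first by case: pA.
move=> t tA; rewrite !hornerE -(subrKA (f t)) (le_trans (ler_normD _ _))//.
rewrite [leRHS]splitr lerD// ltW//; first exact: pN.
by rewrite distrC; exact: pN.
Qed.

(** The norm of [A] is an approximate eigenvalue of [A], so [|p(A)^2|] is at
    least [p(|A|)^2] for polynomials, and one passes to the limit. *)
Lemma cfc_opnorm_sqr_ge (f : R -> R) A S : positive_op A -> 0 < opnorm A ->
  is_cfc f A S -> f (opnorm A) ^+ 2 <= opnorm (S ^+ 2).
Proof.
move=> pA A0 [p [pf pS]]; set M := opnorm A.
have nb := positive_opnorm_spectrum pA A0.
have pM : (p k).[M] @[k --> \oo] --> f M.
  apply/cvgrPdist_le => e e0; move/uniform_cvgP: pf => /(_ _ e0); apply: filterS => k pk.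
  by rewrite distrC ltW//; apply: pk; exact: not_bounded_below_spectrum.
have lim1 : (p k).[M] * (p k).[M] @[k --> \oo] --> f M * f M by apply: cvgM.
have lim2 := cvg_opnorm (op_cvgM pS pS).
rewrite !expr2; apply: ler_cvg_to lim1 lim2 _; apply: nearW => k.
rewrite -op_polyM -hornerM (le_trans (ler_norm _))//.
exact: ler_opnorm_poly.
Qed.

Lemma self_adjoint_cvg (u : nat -> 'B(H)) S :
  (forall k, self_adjoint (u k)) -> op_cvg u S -> self_adjoint S.
Proof.
move=> su uS x y; apply/eqP; rewrite -subr_eq0 -normr_eq0 cabsE.
suff : cabs ('[S x, y] - '[x, S y]) = 0 by move=> ->.
apply/eqP; rewrite eq_le cabs_ge0 andbT.
have lim : opnorm (u k - S) * (2 * hnorm x * hnorm y) @[k --> \oo] --> (0 : R).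
  by rewrite -(mul0r (2 * hnorm x * hnorm y)); apply: cvgMr_tmp.
apply: ler_cvg_to (cvg_cst _) lim _; apply: nearW => k /=.
have -> : '[S x, y] - '[x, S y] = '[x, (u k - S) y] - '[(u k - S) x, y].
  by rewrite !opE linearBl linearBr /= su opprB [RHS]addrC addrA subrK.
rewrite -lecR -cabsE (le_trans (ler_normB _ _))// !cabsE -rmorphD lecR.
apply: (le_trans (lerD (cauchy_schwarz _ _) (cauchy_schwarz _ _))).
have := ler_wpM2l (hnorm_ge0 x) (ler_opnorm (u k - S) y).
have := ler_wpM2r (hnorm_ge0 y) (ler_opnorm (u k - S) x).
lra.
Qed.

(** If [p >= - e] on the spectrum and [p <= c] there, then [|c - p(A)| <= c + e],
    which forces [<p(A) x, x> >= - e |x|^2]. *)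
Lemma cfc_positive (f : R -> R) A S : positive_op A ->
  {within `[0, +oo[%classic, continuous f} -> (forall t, 0 <= t -> 0 <= f t) ->
  is_cfc f A S -> positive_op S.
Proof.
move=> pA cf f0 [p [pf pS]]; have [sA _] := pA; split.
  by apply: self_adjoint_cvg pS => k; exact: self_adjoint_op_poly.
have [K K0 fK] := segment_bounded (@continuous_segment f (opnorm A) cf).
move=> x; have lim : rip (op_poly (p k) A x) x @[k --> \oo] --> rip (S x) x.
  exact/cvg_ripl/op_cvg_app.
suff low (e : R) : 0 < e -> - (e * hnorm x ^+ 2) <= rip (S x) x.
  have [->|x0] := eqVneq x 0; first by rewrite /rip linear0r.
  have hx0 : 0 < hnorm x ^+ 2.
    by rewrite exprn_gt0// hnorm_gt0.
  apply/ler_addgt0Pr => e e0; rewrite -lerBlDr sub0r.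
  by have := low (e / hnorm x ^+ 2) (divr_gt0 e0 hx0); rewrite divfK ?gt_eqF.
move=> e0; apply: ler_cvg_to (cvg_cst _) lim _.
move/uniform_cvgP: pf => /(_ _ e0); apply: filterS => k pk /=.
have : opnorm (op_poly ((K + e)%:P - p k) A) <= K + 2 * e.
  apply: opnorm_poly_le => // [|t tA]; first by rewrite addr_ge0 ?mulr_ge0 ?(ltW e0).
  have /andP[t0 tM] := positive_spectrum pA tA.
  have := pk t tA; have := fK t; rewrite in_itv /= t0 tM => /(_ isT).
  have := f0 t t0; rewrite !hornerE => ft0; rewrite ger0_norm// => ftK.
  by rewrite ltr_norml => /andP[? ?]; rewrite ler_norml; apply/andP; split; lra.
move=> /(ler_wpM2r (hnorm_ge0 x)) /(le_trans (ler_opnorm _ _)) /(ler_wpM2r (hnorm_ge0 x)).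
move=> /(le_trans (le_trans (ler_norm _) (ler_rip _ _))).
rewrite op_polyB op_polyC !opE ripDl ripNl ripZl -hnorm_sqr expr2.
by move: (hnorm x) => h; lra.
Qed.

(** [p^2 - 'X] is small on the spectrum when [p] is close to [f], as [f] is
    bounded there. *)
Lemma cfc_sqr (f : R -> R) A S : positive_op A ->
  {within `[0, +oo[%classic, continuous f} -> (forall t, 0 <= t -> f t ^+ 2 = t) ->
  is_cfc f A S -> S ^+ 2 = A.
Proof.
move=> pA cf ff [p [pf pS]].
have [K K0 fK] := segment_bounded (@continuous_segment f (opnorm A) cf).
rewrite expr2; apply: op_cvg_unique (op_cvgM pS pS) _.
apply/cvgrPdist_le => e e0.
have d0 : 0 < Num.min 1 (e / (2 * K + 1)).
  by rewrite lt_min ltr01 divr_gt0// ltr_wpDl// mulr_ge0.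
move/uniform_cvgP: pf => /(_ _ d0); apply: filterS => k pk.
rewrite sub0r normrN ger0_norm ?opnorm_ge0// -op_polyM -{2}(op_polyX A) -op_polyB.
apply: opnorm_poly_le (ltW e0) _; first by case: pA.
move=> t tA; have /andP[t0 tM] := positive_spectrum pA tA.
have := pk t tA; rewrite lt_min => /andP[p1 pe].
have := fK t; rewrite in_itv /= t0 tM => /(_ isT) ftK.
rewrite !hornerE -[X in _ - X](ff t t0) -expr2 subr_sqr normrM.
have K1 : 0 < 2 * K + 1 by rewrite ltr_wpDl// mulr_ge0.
apply: (@le_trans _ _ (e / (2 * K + 1) * (2 * K + 1))); last by rewrite divfK ?gt_eqF.
apply: ler_pM => //; first exact: (ltW pe).
have -> : (p k).[t] + f t = ((p k).[t] - f t) + (f t + f t) by ring.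
rewrite (le_trans (ler_normD _ _))// (le_trans (lerD (ltW p1) (ler_normD _ _)))//.
by lra.
Qed.

Lemma continuous_sqrt_within (D : set R) : {within D, continuous (@Num.sqrt R)}.
Proof. by apply: continuous_subspaceT; exact: sqrt_continuous. Qed.

Lemma opabs_positive T : positive_op (opabs T).
Proof.
apply: cfc_positive (cfcP _ _); first exact: positive_adjointM.
all: try exact: continuous_sqrt_within; try exact: positive_adjointM.
by move=> t _; exact: sqrtr_ge0.
Qed.

Lemma opabs_sqr T : opabs T ^+ 2 = adjoint T * T.
Proof.
apply: cfc_sqr (cfcP _ _); first exact: positive_adjointM.
all: try exact: continuous_sqrt_within; try exact: positive_adjointM.
by move=> t t0; exact: sqr_sqrtr.
Qed.

Lemma rip_opabs_sqr T x : rip ((opabs T ^+ 2) x) x = hnorm (T x) ^+ 2.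
Proof. by rewrite opabs_sqr opME /rip adjoint_innerl hnorm_sqr. Qed.

Lemma hnorm_opabs T x : hnorm (opabs T x) = hnorm (T x).
Proof.
apply/eqP; rewrite -(@eqrXn2 _ 2) ?hnorm_ge0//; apply/eqP.
have [sA _] := opabs_positive T.
by rewrite -(rip_opabs_sqr T x) hnorm_sqr expr2 opME (rip_self_adjoint (opabs T x) x sA).
Qed.

Lemma opnorm_opabs T : opnorm (opabs T) = opnorm T.
Proof.
apply/eqP; rewrite eq_le; apply/andP; split.
  by apply: opnorm_le => [|x]; rewrite ?opnorm_ge0// hnorm_opabs ler_opnorm.
by apply: opnorm_le => [|x]; rewrite ?opnorm_ge0// -hnorm_opabs ler_opnorm.
Qed.

(** Let [M] be the norm of [T], which is also the norm of [|T|] and of the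
    modulus of its adjoint. The two factors are at least [f(M)] and [g(M)], whose
    product is [M]. *)
Lemma opnorm_le_cfc (f g : R -> R) T :
  (forall t : R, 0 <= t -> 0 <= f t) -> (forall t : R, 0 <= t -> 0 <= g t) ->
  {within `[0, +oo[%classic, continuous f} ->
  {within `[0, +oo[%classic, continuous g} ->
  (forall t : R, 0 <= t -> f t * g t = t) ->
  opnorm T <= Num.sqrt (opnorm (cfc f (opabs T) ^+ 2)) *
              Num.sqrt (opnorm (cfc g (opabs (adjoint T)) ^+ 2)).
Proof.
move=> f0 g0 cf cg fg; have [T0|T0] := eqVneq (opnorm T) 0.
  by rewrite T0 mulr_ge0 ?sqrtr_ge0.
have M0 : 0 < opnorm T by rewrite lt_neqAle eq_sym T0 opnorm_ge0.
have ge h A S : positive_op A -> opnorm A = opnorm T -> is_cfc h A S ->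
    h (opnorm T) ^+ 2 <= opnorm (S ^+ 2).
  by move=> pA AT; rewrite -AT; apply: cfc_opnorm_sqr_ge => //; rewrite AT.
have fM := ge f _ _ (opabs_positive T) (opnorm_opabs T) (cfcP (opabs_positive T) cf).
have gM := ge g _ _ (opabs_positive (adjoint T))
  (etrans (opnorm_opabs (adjoint T)) (opnorm_adjoint T))
  (cfcP (opabs_positive (adjoint T)) cg).
have M_ge0 := ltW M0.
rewrite -[leLHS](fg _ M_ge0); apply: ler_pM; rewrite ?f0 ?g0//.
  by rewrite -[leLHS]ger0_norm ?f0// -sqrtr_sqr ler_wsqrtr ?fM.
by rewrite -[leLHS]ger0_norm ?g0// -sqrtr_sqr ler_wsqrtr ?gM.
Qed.

End continuous_calculus.
(** * Operator matrices *)

Section operator_matrices.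
Context {R : realType}.

Lemma ler_cabs_sum (I : finType) (F : I -> R[i]) :
  cabs (\sum_i F i) <= \sum_i cabs (F i).
Proof.
rewrite -lecR -cabsE rmorph_sum [leRHS](eq_bigr (fun i => `|F i|)) ?ler_norm_sum// => i _.
Qed.

Lemma ler_hnorm_sum (H : hilbertType R) (I : finType) (F : I -> H) :
  hnorm (\sum_i F i) <= \sum_i hnorm (F i).
Proof.
rewrite -lecR -hnormE rmorph_sum [leRHS](eq_bigr (fun i => `|F i|)) ?ler_norm_sum// => i _.
exact/esym/hnormE.
Qed.

Lemma inner_hsumE n (H : hilbertType R) (x y : hsum n H) :
  '[x, y] = \sum_i '[x i, y i].
Proof. by []. Qed.

Lemma rip_op_comb (H : hilbertType R) (S T : 'B(H)) (c d : R) (x : H) :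
  rip ((c%:C *: S + d%:C *: T) x) x = c * rip (S x) x + d * rip (T x) x.
Proof. by rewrite !opE ripDl !ripZl. Qed.

Lemma hnorm_hsum_sqr n (H : hilbertType R) (x : hsum n H) :
  hnorm x ^+ 2 = \sum_i hnorm (x i) ^+ 2.
Proof.
rewrite hnorm_sqr /rip inner_hsumE raddf_sum.
by apply: eq_bigr => i _; rewrite /= hnorm_sqr.
Qed.

Definition real_vector n (h : 'I_n -> R) : hsum n R[i] := [ffun i => (h i)%:C].

Definition real_mxop n (r : 'I_n -> 'I_n -> R) : 'B(hsum n R[i]) :=
  mxop (\matrix_(i, j) (r i j)%:C).

Lemma real_mxopE n (r : 'I_n -> 'I_n -> R) h :
  real_mxop r (real_vector h) = real_vector (fun i => \sum_j r i j * h j).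
Proof.
apply/ffunP => i; rewrite mxopE ffunE rmorph_sum; apply: eq_bigr => j _.
by rewrite mxE ffunE rmorphM.
Qed.

Lemma hnorm_real_vector_sqr n (h : 'I_n -> R) :
  hnorm (real_vector h) ^+ 2 = \sum_i h i ^+ 2.
Proof.
rewrite hnorm_hsum_sqr; apply: eq_bigr => i _.
by rewrite ffunE -[hnorm _]/(cabs (h i)%:C) cabsr -normrX ger0_norm ?sqr_ge0.
Qed.

Lemma rip_real_vector n (h k : 'I_n -> R) :
  rip (real_vector h) (real_vector k) = \sum_i h i * k i.
Proof.
rewrite /rip inner_hsumE raddf_sum.
apply: eq_bigr => i _.
transitivity (complex.Re ((h i)%:C * Num.conj (k i)%:C)); first by rewrite !ffunE.
by rewrite Re_realM Re_conj.
Qed.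

Context {H : hilbertType R} {n : nat}.
Implicit Types (T : 'M['B(H)]_n) (x : hsum n H).

(** It has the same norm as [x], and reduces estimates for operator matrices to
    scalar matrices with nonnegative entries. *)
Definition coord_norms x : hsum n R[i] := real_vector (fun i => hnorm (x i)).

Lemma hnorm_coord_norms x : hnorm (coord_norms x) = hnorm x.
Proof.
apply/eqP; rewrite -(@eqrXn2 _ 2) ?hnorm_ge0//.
by rewrite hnorm_real_vector_sqr hnorm_hsum_sqr.
Qed.

(** The triangle and Cauchy-Schwarz inequalities bound the left-hand side by a
    quadratic form in the norms of the coordinates, and a quadratic form only
    depends on the symmetric part of its matrix. *)
Lemma cabs_inner_opmx_le T (a : 'I_n -> 'I_n -> R) x :
  (forall i j, opnorm (T i j) <= a i j) ->
  cabs '[opmx T x, x] <=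
    rip (real_mxop (fun i j => 2^-1 * (a i j + a j i)) (coord_norms x)) (coord_norms x).
Proof.
move=> Ta; rewrite real_mxopE rip_real_vector.
pose h i := hnorm (x i).
have -> : \sum_i (\sum_j 2^-1 * (a i j + a j i) * h j) * h i =
    \sum_i \sum_j a i j * h j * h i.
  transitivity (2^-1 * (\sum_i \sum_j a i j * h j * h i + \sum_i \sum_j a j i * h j * h i)).
    rewrite -big_split mulr_sumr; apply: eq_bigr => i _ /=.
    rewrite -big_split mulr_sumr mulr_suml; apply: eq_bigr => j _ /=.
    by ring.
  rewrite [X in _ + X]exchange_big /=.
  rewrite [X in _ + X](eq_bigr (fun i => \sum_j a i j * h j * h i)); first by field.
  by move=> i _; apply: eq_bigr => j _; rewrite mulrAC.
rewrite inner_hsumE (le_trans (ler_cabs_sum _))//.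
apply: ler_sum => i _; apply: le_trans (cauchy_schwarz _ _) _.
rewrite -mulr_suml ler_wpM2r ?hnorm_ge0// ffunE (le_trans (ler_hnorm_sum _))//.
apply: ler_sum => j _; apply: le_trans (ler_opnorm _ _) _.
by rewrite ler_wpM2r ?hnorm_ge0.
Qed.

Lemma hnorm_opmx_le T x :
  hnorm (opmx T x) <= hnorm (real_mxop (fun i j => opnorm (T i j)) (coord_norms x)).
Proof.
rewrite -ler_sqr ?nnegrE ?hnorm_ge0// real_mxopE hnorm_real_vector_sqr hnorm_hsum_sqr.
apply: ler_sum => i _; have le : hnorm (opmx T x i) <= \sum_j opnorm (T i j) * hnorm (x j).
  rewrite ffunE (le_trans (ler_hnorm_sum _))//.
  by apply: ler_sum => j _; exact: ler_opnorm.
by rewrite ler_sqr ?nnegrE ?hnorm_ge0// (le_trans _ le) ?hnorm_ge0.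
Qed.

(** Let [v] be the vector of norms of the coordinates of a unit vector [x], and
    [A], [B] the two scalar matrices. Then [|<T x, x>| <= <A v, v> <= |A v|] and
    [|T x| <= |B v|], while [|A v|^2 = <|A|^2 v, v>] and likewise for [B]. So the
    quantity under the root in the definition of the alpha-norm is at most the
    value at [v] of the quadratic form of the operator on the right. *)
Lemma alpha_norm_opmx_le T (a : 'I_n -> 'I_n -> R) (alpha : R) :
  0 <= alpha <= 1 -> (forall i j, opnorm (T i j) <= a i j) ->
  alpha_norm alpha (opmx T) <=
  Num.sqrt (opnorm (alpha%:C *: opabs (real_mxop (fun i j => 2^-1 * (a i j + a j i))) ^+ 2 +
    (1 - alpha)%:C *: opabs (real_mxop (fun i j => opnorm (T i j))) ^+ 2)).
Proof.
move=> /andP[a0 a1] Ta.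
set A := real_mxop _; set B := real_mxop _; set Q := _ + _.
rewrite /alpha_norm; set E := [set _ | _ in _].
(* There are no unit vectors when [H] or [n] is zero. *)
have [->|/set0P E0] := eqVneq E set0; first by rewrite sup0 sqrtr_ge0.
apply: ge_sup => // _ [x x1 <-]; apply: ler_wsqrtr.
rewrite -[complex.Re `|opmx T x|]/(hnorm _) -[complex.Re `|inner _ _|]/(cabs _).
pose v := coord_norms x.
have v1 : hnorm v = 1 by rewrite hnorm_coord_norms; apply: complexI; rewrite -hnormE x1.
have QE : rip (Q v) v = alpha * hnorm (A v) ^+ 2 + (1 - alpha) * hnorm (B v) ^+ 2.
  by rewrite -(rip_opabs_sqr A v) -(rip_opabs_sqr B v) -rip_op_comb.
have Q_le : rip (Q v) v <= opnorm Q.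
  have := ler_rip (Q v) v; have := ler_opnorm Q v; rewrite v1 !mulr1 => Qv.
  by move=> /(le_trans (ler_norm _)) /le_trans; apply.
apply: le_trans Q_le; rewrite QE; apply: lerD.
  apply: ler_wpM2l => //; rewrite ler_sqr ?nnegrE ?cabs_ge0 ?hnorm_ge0//.
  apply: le_trans (cabs_inner_opmx_le x Ta) _.
  by apply: le_trans (le_trans (ler_norm _) (ler_rip _ _)) _; rewrite v1 mulr1.
apply: ler_wpM2l; rewrite ?subr_ge0// ler_sqr ?nnegrE ?hnorm_ge0//.
exact: hnorm_opmx_le.
Qed.

End operator_matrices.

Theorem theorem2p11 (R : realType) (H : hilbertType R) (alpha : R) (n : nat)
    (T : 'M['B(H)]_n) (f g : R -> R)
    (alpha01 : 0 <= alpha <= 1)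
    (f_ge0 : forall t : R, 0 <= t -> 0 <= f t)
    (g_ge0 : forall t : R, 0 <= t -> 0 <= g t)
    (f_cont : {within `[0, +oo[%classic, continuous f})
    (g_cont : {within `[0, +oo[%classic, continuous g})
    (fg : forall t : R, 0 <= t -> f t * g t = t) :
  let a (i j : 'I_n) : R :=
    Num.sqrt (opnorm (cfc f (opabs (T i j)) ^+ 2)) *
    Num.sqrt (opnorm (cfc g (opabs (adjoint (T i j))) ^+ 2)) in
  let Rmx : 'M[R[i]]_n := \matrix_(i, j) (2^-1 * (a i j + a j i))%:C in
  let Smx : 'M[R[i]]_n := \matrix_(i, j) (opnorm (T i j))%:C in
  alpha_norm alpha (opmx T) <=
  Num.sqrt (opnorm (alpha%:C *: opabs (mxop Rmx) ^+ 2 +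
                    (1 - alpha)%:C *: opabs (mxop Smx) ^+ 2)).
Proof.
apply: (alpha_norm_opmx_le (a := fun i j =>
  Num.sqrt (opnorm (cfc f (opabs (T i j)) ^+ 2)) *
  Num.sqrt (opnorm (cfc g (opabs (adjoint (T i j))) ^+ 2)))) => // i j.
exact: opnorm_le_cfc.
Qed.
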